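(* Let $\mathbf{A}$ be a finite expanded group whose ideal lattice $\mathrm{Id}(\mathbf{A})$ is $\mathbb{M}_2$-free, and let $\{0\}=S_0<\cdots<S_n=A$ be the set of all those ideals that cut the lattice $\mathrm{Id}(\mathbf{A})$. Then the following are equivalent: (1) The clone of congruence preserving functions of $\mathbf{A}$ is finitely generated. (2) For each $i\in\{0,\dots,n-1\}$, the interval $\mathbb{I}[S_i,S_{i+1}]$ of the lattice $\mathrm{Id}(\mathbf{A})$ either contains exactly the two elements $S_i$ and $S_{i+1}$, or $\mathbb{I}[S_i,S_{i+1}]$ does not split.
   Context: An expanded group is an algebra $\mathbf{A}=(A,F)$ having operations $+$ (binary), $-$ (unary), $0$ (nullary) among its fundamental operations such that $(A,+,-,0)$ is a (not necessarily abelian) group. An ideal of $\mathbf{A}$ is a subset $I\subseteq A$ that is a normal subgroup of $(A,+)$ and satisfies $f(a_1+i_1,\dots,a_k+i_k)-f(a_1,\dots,a_k)\in I$ for every $k\in\mathbb{N}$, every $k$-ary fundamental operation $f$, all $a\in A^k$ and $i\in I^k$. The set $\mathrm{Id}(\mathbf{A})$ of ideals, with operations $+$ and $\cap$, is a lattice isomorphic to the congruence lattice of $\mathbf{A}$ via $\alpha\mapsto 0/\alpha$. A function $f:A^k\to A$ is congruence preserving if for every congruence $\alpha$ of $\mathbf{A}$ and all $(a_1,b_1),\dots,(a_k,b_k)\in\alpha$ we have $(f(a_1,\dots,a_k),f(b_1,\dots,b_k))\in\alpha$. The congruence preserving functions of all arities $k\ge1$ form a clone (a set of finitary operations containing all projections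 and closed under composition); it is finitely generated if it has a finite subset $F$ such that each of its members is a composition of projections and functions in $F$. For $a\le b$ in a lattice $\mathbb{L}$, $\mathbb{I}[a,b]=\{c\in\mathbb{L}:a\le c\le b\}$. $\mathbb{M}_2$ is the four-element Boolean lattice; a lattice is $\mathbb{M}_2$-free if none of its intervals is isomorphic to $\mathbb{M}_2$. An element $\beta$ of a bounded lattice cuts the lattice if every $\alpha$ in it satisfies $\alpha\le\beta$ or $\alpha\ge\beta$; the cutting elements form a chain containing the least and greatest elements. A bounded lattice $\mathbb{L}$ with least element $\mathbf 0$ and greatest element $\mathbf 1$ splits if there are $\delta,\varepsilon\in\mathbb{L}$ with $\delta<\mathbf 1$, $\varepsilon>\mathbf 0$ such that every $\alpha\in\mathbb{L}$ satisfies $\alpha\le\delta$ or $\alpha\ge\varepsilon$. *)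

(* Defs.v *)
From HB Require Import structures.
From mathcomp Require Import all_boot all_order all_fingroup.
From mathcomp Require Import boolp.

Set Implicit Arguments.
Unset Strict Implicit.
Unset Printing Implicit Defensive.

Import Order.TTheory.

Definition operation (T : finType) (k : nat) := {ffun k.-tuple T -> T}.

(* A set of finitary operations: [F k f] says that the k-ary [f] belongs to F. *)
Definition opset (T : finType) := forall k : nat, operation T k -> Prop.

Definition preserves (T : finType) (alpha : rel T) (k : nat)
    (f : operation T k) : Prop :=
  forall a b : k.-tuple T,
    (forall j, alpha (tnth a j) (tnth b j)) -> alpha (f a) (f b).

Definition congruence (T : finType) (F : opset T) (alpha : rel T) : Prop :=
  [/\ reflexive alpha, symmetric alpha, transitive alpha
    & forall (k : nat) (f : operation T k), F k f -> preserves alpha f].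

(* The clone has no nullary members. *)
Definition congruence_preserving (T : finType) (F : opset T) : opset T :=
  fun k f => 0 < k /\ forall alpha, congruence F alpha -> preserves alpha f.

Definition proj_op (T : finType) (k : nat) (i : 'I_k) : operation T k :=
  [ffun x => tnth x i].

Definition comp_op (T : finType) (n k : nat) (f : operation T n)
    (g : 'I_n -> operation T k) : operation T k :=
  [ffun x => f [tuple g i x | i < n]].

Inductive clone_generated (T : finType) (G : opset T) :
    forall k : nat, operation T k -> Prop :=
| Clone_gen k (f : operation T k) : G k f -> clone_generated G f
| Clone_proj k (i : 'I_k) : clone_generated G (proj_op T i)
| Clone_comp n k (f : operation T n) (g : 'I_n -> operation T k) :
    clone_generated G f -> (forall i, clone_generated G (g i)) ->
    clone_generated G (comp_op f g).

(* A finite set of operations, possibly of different arities, is given by a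
   list of arity-tagged operations. *)
Definition opset_of_seq (T : finType)
    (s : seq {k : nat & operation T k}) : opset T :=
  fun k f => Tagged (operation T) f \in s.

Definition finitely_generated (T : finType) (C : opset T) : Prop :=
  exists s : seq {k : nat & operation T k},
    (forall (k : nat) (f : operation T k), opset_of_seq s f -> C k f) /\
    (forall (k : nat) (f : operation T k),
       C k f -> clone_generated (opset_of_seq s) f).

Section LatticeNotions.
Local Open Scope order_scope.

Definition lat_interval {d : Order.disp_t} {L : finTBLatticeType d} (a b : L) :
    {set L} :=
  [set c | a <= c <= b].

(* Intervals are sublattices, so a lattice isomorphism from the four-element
   Boolean lattice [bool *p bool] onto an interval is an injective lattice
   morphism to L whose image is that interval. *)
Definition isomorphic_M2 {d : Order.disp_t} {L : finTBLatticeType d} (a b : L) :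
    Prop :=
  exists phi : bool *p bool -> L,
    [/\ injective phi,
        {morph phi : x y / x `&` y},
        {morph phi : x y / x `|` y}
      & forall c : L, c \in lat_interval a b <-> exists x, phi x = c].

Definition M2_free {d : Order.disp_t} (L : finTBLatticeType d) : Prop :=
  forall a b : L, a <= b -> ~ isomorphic_M2 a b.

Definition cuts {d : Order.disp_t} {L : finTBLatticeType d} (beta : L) : Prop :=
  forall alpha : L, alpha <= beta \/ beta <= alpha.

(* The bounded lattice with carrier [lat_interval a b], least element a and
   greatest element b, splits. *)
Definition interval_splits {d : Order.disp_t} {L : finTBLatticeType d}
    (a b : L) : Prop :=
  exists delta epsilon : L,
    [/\ delta \in lat_interval a b, epsilon \in lat_interval a b,
        delta < b, a < epsilon
      & forall alpha, alpha \in lat_interval a b ->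
          alpha <= delta \/ epsilon <= alpha].

End LatticeNotions.

Section Ideals.
Local Open Scope group_scope.

(* The group (A, +, -, 0), not necessarily abelian, is a [finGroupType] written
   multiplicatively: [x * y], [x^-1] and [1] stand for x + y, - x and 0. *)
Definition expanded_group (gT : finGroupType) (F : opset gT) : Prop :=
  [/\ F 2%N [ffun x => tnth x ord0 * tnth x ord_max],
      F 1%N [ffun x => (tnth x ord0)^-1]
    & F 0%N [ffun _ => 1]].

Definition is_ideal (gT : finGroupType) (F : opset gT) (I : {group gT}) :
    Prop :=
  I <| [set: gT] /\
  forall (k : nat) (f : operation gT k), F k f ->
    forall a i : k.-tuple gT, (forall j, tnth i j \in I) ->
      f [tuple tnth a j * tnth i j | j < k] * (f a)^-1 \in I.

Record ideal (gT : finGroupType) (F : opset gT) := Ideal {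
  ideal_group :> {group gT};
  ideal_groupP : `[< is_ideal F ideal_group >] }.

HB.instance Definition _ (gT : finGroupType) (F : opset gT) :=
  [isSub for @ideal_group gT F].
HB.instance Definition _ (gT : finGroupType) (F : opset gT) :=
  [Finite of ideal F by <:].

End Ideals.

Section IdealLattice.
Local Open Scope group_scope.
Variables (gT : finGroupType) (F : opset gT).
Implicit Types I J K : ideal F.

Lemma idealP I : is_ideal F I.
Proof. exact/asboolP/ideal_groupP. Qed.

Lemma ideal_inj I J : I = J :> {set gT} -> I = J.
Proof. by move=> eIJ; apply/val_inj/group_inj. Qed.

Fact ideal1_subproof : `[< is_ideal F 1%G >].
Proof.
apply/asboolP; split; first exact: normal1.
move=> k f _ a i i1; suff -> : [tuple tnth a j * tnth i j | j < k] = a.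
  by rewrite mulgV group1.
apply: eq_from_tnth => j; rewrite tnth_mktuple.
by have /set1P-> := i1 j; rewrite mulg1.
Qed.

Fact idealT_subproof : `[< is_ideal F [set: gT]%G >].
Proof. by apply/asboolP; split=> [|k f _ a i _]; rewrite ?inE ?normal_refl. Qed.

Fact idealI_subproof I J : `[< is_ideal F (I :&: J)%G >].
Proof.
have [[nI cI] [nJ cJ]] := (idealP I, idealP J).
apply/asboolP; split=> [|k f Ff a i iIJ]; first exact: normalI.
rewrite inE cI ?cJ // => j; by have /setIP[] := iIJ j.
Qed.

Lemma ideal_joingE I J : I <*> J = I * J.
Proof.
have [[/andP[_ nI] _] _] := (idealP I, idealP J).
by rewrite norm_joinEr // (subset_trans _ nI) ?subsetT.
Qed.

Fact idealU_subproof I J : `[< is_ideal F (I <*> J)%G >].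
Proof.
have [[nI cI] [nJ cJ]] := (idealP I, idealP J).
apply/asboolP; split=> [|k f Ff a i iIJ]; first exact: normalY.
pose u j := odflt 1 [pick x in I | x^-1 * tnth i j \in J].
have uP j : u j \in I /\ (u j)^-1 * tnth i j \in J.
  rewrite /u; case: pickP => [x /andP[] //|no].
  have := iIJ j; rewrite /= ideal_joingE => /mulsgP[x y xI yJ exy].
  by have := no x; rewrite xI exy mulKg yJ.
pose b := [tuple tnth a j * u j | j < k].
pose v := [tuple (u j)^-1 * tnth i j | j < k].
have eb : [tuple tnth a j * tnth i j | j < k]
        = [tuple tnth b j * tnth v j | j < k].
  by apply: eq_from_tnth => j; rewrite !tnth_mktuple -mulgA mulKVg.
have bI : f b * (f a)^-1 \in I.
  have := cI k f Ff a [tuple u j | j < k].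
  have -> : [tuple tnth a j * tnth [tuple u j | j < k] j | j < k] = b.
    by apply: eq_from_tnth => j; rewrite !tnth_mktuple.
  by apply=> j; rewrite tnth_mktuple; case: (uP j).
have vJ : f [tuple tnth b j * tnth v j | j < k] * (f b)^-1 \in J.
  by apply: cJ => // j; rewrite tnth_mktuple; case: (uP j).
rewrite eb -(mulgKV (f b) (f _)) -mulgA.
by apply: groupM; rewrite mem_gen // inE ?vJ ?bI ?orbT.
Qed.

Definition ideal1 : ideal F := Ideal ideal1_subproof.
Definition idealT : ideal F := Ideal idealT_subproof.
Definition idealI I J : ideal F := Ideal (idealI_subproof I J).
(* The sum I + J, written I * J here; see [ideal_joinE]. *)
Definition idealU I J : ideal F := Ideal (idealU_subproof I J).
Definition ideal_le I J := I \subset J.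

Fact ideal_le_refl : reflexive ideal_le.
Proof. by move=> I; apply: subxx. Qed.

Fact ideal_le_anti : antisymmetric ideal_le.
Proof. by move=> I J sIJ; apply: ideal_inj; apply/eqP; rewrite eqEsubset. Qed.

Fact ideal_le_trans : transitive ideal_le.
Proof. by move=> J I K; apply: subset_trans. Qed.

Fact ideal_meetP I J K : ideal_le I (idealI J K) = ideal_le I J && ideal_le I K.
Proof. exact: subsetI. Qed.

Fact ideal_joinP I J K : ideal_le (idealU I J) K = ideal_le I K && ideal_le J K.
Proof. exact: join_subG. Qed.

Fact ideal_le1 I : ideal_le ideal1 I.
Proof. exact: sub1G. Qed.

Fact ideal_leT I : ideal_le I idealT.
Proof. exact: subsetT. Qed.

Fact ideal_display : Order.disp_t.
Proof. exact: Order.Disp tt tt. Qed.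

HB.instance Definition _ := Order.Le_isPOrder.Build ideal_display (ideal F)
  ideal_le_refl ideal_le_anti ideal_le_trans.
HB.instance Definition _ :=
  Order.POrder_MeetJoin_isLattice.Build ideal_display (ideal F)
    ideal_meetP ideal_joinP.
HB.instance Definition _ :=
  Order.hasBottom.Build ideal_display (ideal F) ideal_le1.
HB.instance Definition _ :=
  Order.hasTop.Build ideal_display (ideal F) ideal_leT.

Lemma ideal_leE I J : (I <= J)%O = (I \subset J).
Proof. by []. Qed.

Lemma ideal_meetE I J : (I `&` J)%O = I :&: J :> {set gT}.
Proof. by []. Qed.

Lemma ideal_joinE I J : (I `|` J)%O = I * J :> {set gT}.
Proof. exact: ideal_joingE. Qed.

Lemma ideal_botE : (\bot : ideal F)%O = 1 :> {set gT}.
Proof. by []. Qed.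

Lemma ideal_topE : (\top : ideal F)%O = [set: gT] :> {set gT}.
Proof. by []. Qed.

End IdealLattice.

(* Main.v *)
Require Import Defs.
From HB Require Import structures.
From mathcomp Require Import all_boot all_order all_fingroup all_solvable.
From mathcomp Require Import all_algebra mxabelem boolp.

(** Throughout, a function is compatible when it respects every ideal; the
    clone in question consists of the compatible functions of positive arity.
    Write D < B for two consecutive cutting ideals. Because D and B cut the
    lattice, every ideal other than those strictly between them lies below D
    or above B, so a function with values in B, considered modulo D, only has
    to respect the ideals of the layer from D to B.

    If every layer is simple or does not split, the compatible functions of
    bounded arity generate the clone. Going down the chain, it suffices to
    approximate modulo D a compatible f with values in B. In a layer that is
    just {D, B}, every function that is constant modulo D and has values in B
    is compatible, and f is a product of functions, each supported on one class
    modulo D, built from a binary selector ([gen_glue]). In a layer that does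
    not split, the selector distinguishes only classes modulo B, so f has to
    be understood on each product of cosets of B. There, absorbing functions
    of many variables vanish modulo D ([absorbing_vanish]): for every ideal
    e with D < e <= B, the ideals of the layer not above e join to B, since
    otherwise their join and e would split the layer. Hence each argument may
    be moved through ideals not above a prescribed e; assigning one argument to
    each e confines the value to an ideal above no e, that is, to D.
    Consequently f is, on such a coset and modulo D, a product of functions of
    boundedly many variables.

    Conversely, let a layer have more than two elements. In an M2-free
    lattice two distinct lower covers of an ideal always have a third companion,
    hence lie in a diamond M3. As no ideal strictly inside the layer cuts, all
    covering pairs of the layer are connected by transpositions
    ([covers_transposed]); the diamond below B makes the top covering pairs
    central, and so all covering pairs a < b of the layer are central of the
    same prime exponent p ([all_covers_pcentral]): modulo a, the increment of a
    compatible function in directions from b is additive and depends only on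
    the class modulo B of the base point. Evaluate the functions generated by
    finitely many operations at arguments in {1, b0}, with b0 in B. By downward
    induction along the layer, their composites with functions into the field
    with p elements have bounded degree, the bound being independent of the
    number of variables ([term_degree]): passing to a lower cover, the new
    coordinates are obtained from the old ones by additive maps plus
    arbitrary functions of boundedly many values of already bounded degree.
    If moreover delta and eps split the layer, the function with value
    e in eps when all its arguments are outside delta, and 1 otherwise, is
    compatible; choosing b0 outside delta and e outside D, it is the monomial
    of full degree on the cube. So no finite set generates the clone. *)

Set Implicit Arguments.
Unset Strict Implicit.
Unset Printing Implicit Defensive.

Import Order.TTheory.

(** * Congruence preserving functions and ideals *)

Section Compatible.
Local Open Scope group_scope.
Variables (gT : finGroupType) (F : opset gT).
Implicit Types (I J : ideal F) (x y : gT).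

Lemma ideal_norm I x : x \in 'N(I).
Proof. by have [/andP[_ /subsetP nI] _] := idealP I; apply: nI; rewrite inE. Qed.

(** The class of x modulo I, written in the quotient group so that
    congruences can be rewritten as equations. *)
Definition cls I x : coset_of I := coset I x.

Lemma clsM I x y : cls I (x * y) = cls I x * cls I y.
Proof. by rewrite /cls morphM ?ideal_norm. Qed.

Lemma clsV I x : cls I x^-1 = (cls I x)^-1.
Proof. by rewrite /cls morphV ?ideal_norm. Qed.

Lemma clsX I x m : cls I (x ^+ m) = cls I x ^+ m.
Proof. by rewrite /cls morphX ?ideal_norm. Qed.

Lemma cls1 I : cls I 1 = 1.
Proof. exact: morph1. Qed.

Lemma cls_eq1 I x : (cls I x == 1) = (x \in I).
Proof.
by apply/eqP/idP => [/coset_idr -> //|/coset_id //]; rewrite ideal_norm.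
Qed.

Lemma cls_eq I x y : (cls I x == cls I y) = (x^-1 * y \in I).
Proof. by rewrite -cls_eq1 clsM clsV eq_mulVg1. Qed.

Lemma cls_in I x : x \in I -> cls I x = 1.
Proof. by rewrite -cls_eq1 => /eqP. Qed.

Lemma cls_le I J x y : (I <= J)%O -> cls I x = cls I y -> cls J x = cls J y.
Proof. by move=> /subsetP sIJ /eqP; rewrite cls_eq => /sIJ h; apply/eqP; rewrite cls_eq. Qed.

Lemma cls_mem I J x y : (I <= J)%O -> cls I x = cls I y -> (x \in J) = (y \in J).
Proof. by move=> sIJ /(cls_le sIJ) e; rewrite -!cls_eq1 e. Qed.

(** A representative chosen from the class alone. *)
Definition rep I x : gT := repr (cls I x).

Lemma cls_rep I x : cls I (rep I x) = cls I x.
Proof. exact: coset_reprK. Qed.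

Lemma rep_cls I x y : cls I x = cls I y -> rep I x = rep I y.
Proof. by rewrite /rep => ->. Qed.

Definition tcls k I (u v : k.-tuple gT) := forall j, cls I (tnth u j) = cls I (tnth v j).

Definition compatible k (f : k.-tuple gT -> gT) :=
  forall I (u v : k.-tuple gT), tcls I u v -> cls I (f u) = cls I (f v).

Lemma ideal_congruence I : congruence F (fun x y => cls I x == cls I y).
Proof.
split=> [x|x y|y x z /= /eqP-> //|k f Ff a b ab] //=.
have [_ /(_ k f Ff a [tuple (tnth a j)^-1 * tnth b j | j < k])] := idealP I.
have -> : [tuple tnth a j * tnth [tuple (tnth a i)^-1 * tnth b i | i < k] j | j < k] = b.
  by apply: eq_from_tnth => j; rewrite !tnth_mktuple mulKVg.
rewrite -cls_eq1 clsM clsV -eq_mulgV1 eq_sym; apply=> j.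
by rewrite tnth_mktuple -cls_eq.
Qed.

Hypothesis F_expanded : expanded_group F.

(** The class of 1 under a congruence is an ideal because the group operations
    are among the fundamental operations; translations then recover the whole
    congruence from that class. *)
Lemma congruence_ideal (alpha : rel gT) : congruence F alpha ->
  exists I : ideal F, forall x y, alpha x y = (cls I x == cls I y).
Proof.
move=> [refl sym tr pres]; have [FM FV F1] := F_expanded.
have aM x x' y y' : alpha x x' -> alpha y y' -> alpha (x * y) (x' * y').
  move=> ax ay; have := pres _ _ FM [tuple x; y] [tuple x'; y'].
  rewrite !ffunE !(tnth_nth 1) /=; apply=> -[[|[|//]] lt_i] /=;
  by rewrite !(tnth_nth 1).
have aV x x' : alpha x x' -> alpha x^-1 x'^-1.
  move=> ax; have := pres _ _ FV [tuple x] [tuple x'].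
  rewrite !ffunE !(tnth_nth 1) /=; apply=> -[[|//] lt_i] /=;
  by rewrite !(tnth_nth 1).
pose I0 := [set x | alpha 1 x].
have gI : group_set I0.
  apply/group_setP; split=> [|x y]; rewrite !inE // => ax ay.
  by rewrite -(mulg1 1) aM.
have aE x y : alpha x y = (x^-1 * y \in I0).
  rewrite inE; apply/idP/idP => h; first by rewrite -(mulVg x) aM.
  by rewrite -[x]mulg1 -[y](mulKVg x) aM.
have idI : is_ideal F (Group gI).
  split.
    apply/andP; split; first exact: subsetT.
    apply/subsetP=> x _; rewrite inE; apply/subsetP=> _ /imsetP[y + ->].
    by rewrite !inE => ay; rewrite -(conj1g x) /conjg !aM.
  move=> k f Ff a i iI.
  have : alpha (f a) (f [tuple tnth a j * tnth i j | j < k]).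
    apply: pres Ff _ _ _ => j; rewrite tnth_mktuple -{1}[tnth a j]mulg1 aM //.
    by have := iI j; rewrite inE.
  by move=> h; rewrite inE /= -(mulgV (f a)) aM.
exists (Ideal (introT (asboolP _) idI)) => x y.
by rewrite aE cls_eq.
Qed.

Lemma congruence_preservingP k (f : operation gT k) :
  congruence_preserving F f <-> 0 < k /\ compatible f.
Proof.
split=> -[k0 h]; split=> //.
  move=> I u v uv; apply/eqP; apply: (h _ (ideal_congruence I)) => j.
  exact/eqP/uv.
move=> alpha /congruence_ideal[I eI] u v uv; rewrite eI; apply/eqP/h => j.
by have := uv j; rewrite eI => /eqP.
Qed.

Lemma fundamental_compatible k (f : operation gT k) : F f -> compatible f.
Proof.
move=> Ff I u v uv; apply/eqP; have [_ _ _ h] := ideal_congruence I.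
by apply: h Ff _ _ _ => j; apply/eqP.
Qed.

(** Arguments congruent modulo an ideal below [delta] give equal values, and an
    ideal above [eps] contains all values. *)
Lemma split_compatible (delta eps : ideal F) k (f : k.-tuple gT -> gT) :
  (forall alpha : ideal F, alpha <= delta \/ eps <= alpha)%O ->
  (forall u v, tcls delta u v -> f u = f v) -> (forall u, f u \in eps) ->
  compatible f.
Proof.
move=> sp inv ran I u v uv; have [le|/subsetP le] := sp I.
  by rewrite (inv u v) // => j; apply: cls_le le _.
by rewrite !cls_in ?le.
Qed.

Lemma ideal_card_lt I J : (I < J)%O -> #|I| < #|J|.
Proof.
move=> IJ; apply: proper_card.
by rewrite properEneq (inj_eq (@ideal_inj _ _)) -lt_neqAle.
Qed.

Lemma max_ideal (P : ideal F -> Prop) I : P I ->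
  exists J : ideal F, [/\ (I <= J)%O, P J & forall K : ideal F, (J < K)%O -> ~ P K].
Proof.
move: {2}_.+1 (ltnSn (#|gT| - #|I|)) => m; elim: m I => // m IHm I ltm PI.
have [[J [IJ PJ]]|no] := pselect (exists J, (I < J)%O /\ P J); last first.
  by exists I; split=> // K IK PK; apply: no; exists K.
have ltc := ideal_card_lt IJ.
have [|K [JK PK mK]] := IHm J _ PJ.
  have leJ : #|J| <= #|gT| by apply: max_card.
  by rewrite -ltnS (leq_trans _ ltm) // ltnS ltn_sub2l // (leq_trans ltc).
by exists K; split=> //; apply: le_trans JK; apply: ltW.
Qed.

End Compatible.

(** * Gluing local approximations *)

Section Generation.
Local Open Scope group_scope.
Variables (gT : finGroupType) (F : opset gT).
Hypothesis F_expanded : expanded_group F.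
Variable N : nat.
Hypothesis N_ge2 : 2 <= N.

Definition small_ops : opset gT := fun k f => k <= N /\ congruence_preserving F f.

(** Plain functions are easier to compose than finite functions: all closure
    properties below are stated for them. *)
Definition gen k (f : k.-tuple gT -> gT) := clone_generated small_ops [ffun x => f x].

Lemma gen_ext k (f g : k.-tuple gT -> gT) : (forall x, f x = g x) -> gen f -> gen g.
Proof.
by move=> e; rewrite /gen; under [in X in X -> _]eq_ffun do rewrite e.
Qed.

Lemma gen_comp m k (h : m.-tuple gT -> gT) (g : 'I_m -> k.-tuple gT -> gT) :
  0 < m <= N -> compatible F h -> (forall i, gen (g i)) ->
  gen (fun x => h [tuple g i x | i < m]).
Proof.
move=> /andP[m0 mN] ch gg.
have hh : small_ops [ffun x => h x].
  split=> //; apply/congruence_preservingP => //; split=> // I u v uv.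
  by rewrite !ffunE; apply: ch.
have := Clone_comp (Clone_gen hh) gg; congr clone_generated.
apply/ffunP=> x; rewrite !ffunE; congr h; apply: eq_from_tnth => j.
by rewrite !tnth_mktuple ffunE.
Qed.

Lemma gen_proj k (i : 'I_k) : gen (fun x => tnth x i).
Proof. exact: Clone_proj. Qed.

Definition compatible2 (h : gT -> gT -> gT) := forall (I : ideal F) x x' y y',
  cls I x = cls I x' -> cls I y = cls I y' -> cls I (h x y) = cls I (h x' y').

Lemma gen2 h k (f g : k.-tuple gT -> gT) :
  compatible2 h -> gen f -> gen g -> gen (fun x => h (f x) (g x)).
Proof.
move=> ch gf gg.
pose h2 (u : 2.-tuple gT) := h (tnth u ord0) (tnth u ord_max).
pose fg (i : 'I_2) := if i == ord0 then f else g.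
apply: (@gen_ext _ (fun x => h2 [tuple fg i x | i < 2])) => [x|].
  by rewrite /h2 !tnth_mktuple.
apply: gen_comp => // [I u v uv|i]; first exact: ch.
by rewrite /fg; case: ifP.
Qed.

Lemma gen_const k c : 0 < k -> @gen k (fun _ => c).
Proof.
case: k => // k _.
by apply: (@gen2 (fun _ _ => c) _ _ _ _ (gen_proj ord0) (gen_proj ord0)).
Qed.

Lemma gen_mul k (f g : k.-tuple gT -> gT) : gen f -> gen g -> gen (fun x => f x * g x).
Proof. by apply: gen2 => I x x' y y' ex ey; rewrite !clsM ex ey. Qed.

Lemma gen_prod k (T : Type) (r : seq T) (f : T -> k.-tuple gT -> gT) : 0 < k ->
  (forall t, gen (f t)) -> gen (fun x => \prod_(t <- r) f t x).
Proof.
move=> k0 gf; elim: r => [|t r IHr].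
  by apply: gen_ext (gen_const 1 k0) => x; rewrite big_nil.
by apply: gen_ext (gen_mul (gf t) IHr) => x; rewrite big_cons.
Qed.

(** For a tuple t of representatives modulo E, nesting the selectors
    [m (tnth t j)] over all coordinates j yields a function M t that agrees
    modulo D with the local approximation h t on the classes of t and is
    trivial modulo D elsewhere. The product of the M t over all tuples has at
    each point exactly one factor that matters. *)
Lemma gen_glue (D B E : ideal F) (m : gT -> gT -> gT -> gT) k (f : k.-tuple gT -> gT) :
  (D <= B)%O -> 0 < k ->
  (forall s, compatible2 (m s)) ->
  (forall s x y, cls D (m s x y) = if (rep E x == s) && (y \in B) then cls D y else 1) ->
  (forall u, f u \in B) ->
  (forall t, exists2 h, gen h & forall u, tcls E u t -> cls D (h u) = cls D (f u)) ->
  exists2 g, gen g & forall u, cls D (g u) = cls D (f u).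
Proof.
move=> leDB k0 cm mE fB loc.
have {loc}/(_ _)/cid2 loc := loc.
pose h t := sval (loc t).
have gh t : gen (h t) by rewrite /h; case: (loc t).
have hE t u : tcls E u t -> cls D (h t u) = cls D (f u).
  by rewrite /h; case: (loc t) => h0 _ /= e; apply: e.
pose M (t : k.-tuple gT) (r : seq 'I_k) u :=
  foldr (fun j y => m (tnth t j) (tnth u j) y) (h t u) r.
have gM t r : gen (M t r).
  rewrite /M; elim: r => [|j r IHr]; first exact: gh.
  exact: (gen2 (cm _) (gen_proj _) IHr).
have ME t r u : cls D (M t r u) = if all (fun j => rep E (tnth u j) == tnth t j) r then
    if (h t u \in B) || (r == [::]) then cls D (h t u) else 1 else 1.
  elim: r => [|j r IHr] //=; first by rewrite orbT.
  rewrite mE orbF; case: eqP => //= _.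
  have -> : (M t r u \in B) = (cls B (M t r u) == 1) by rewrite cls_eq1.
  move: IHr; case: ifP => _ IHr.
    case: (boolP (h t u \in B)) IHr => /= hB IHr.
      by rewrite (cls_le leDB IHr) cls_in // eqxx.
    case: r IHr => [|j' r] /= IHr; last first.
      by rewrite IHr if_same.
    by rewrite cls_eq1 (negPf hB).
  by rewrite IHr if_same.
exists (fun u => \prod_(t : k.-tuple gT) M t (enum 'I_k) u).
  exact: gen_prod.
move=> u; pose t := [tuple rep E (tnth u j) | j < k].
have et t' : cls D (M t' (enum 'I_k) u) = if t' == t then cls D (f u) else 1.
  (* Only the tuple of representatives of the classes of u selects u. *)
  rewrite ME; case: (t' =P t) => [->|ne].
    have ut : tcls E u t by move=> j; rewrite tnth_mktuple cls_rep.
    rewrite ifT; last by apply/allP=> j _; rewrite tnth_mktuple.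
    by rewrite (cls_mem leDB (hE _ _ ut)) fB /= hE.
  case: allP => // h'; case: ne; apply: eq_from_tnth => j.
  by rewrite tnth_mktuple; apply/esym/eqP/h'; rewrite mem_enum.
have -> : cls D (\prod_(t : k.-tuple gT) M t (enum 'I_k) u) =
   \prod_(t : k.-tuple gT) cls D (M t (enum 'I_k) u).
  by elim: (index_enum _) => [|a r IHr]; rewrite ?big_nil ?cls1 // !big_cons clsM IHr.
under eq_bigr do rewrite et.
by rewrite -big_mkcond big_pred1_eq.
Qed.

End Generation.

(** * Absorbing functions in a layer that does not split *)

Section NonSplit.
Local Open Scope group_scope.
Variables (gT : finGroupType) (F : opset gT).
Hypothesis F_expanded : expanded_group F.
Variable N : nat.
Hypothesis N_ge2 : 2 <= N.
Hypothesis N_large : #|{: ideal F}| <= N.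

Variables (D B : ideal F).
Hypothesis leDB : (D <= B)%O.
Hypothesis nonsplit : ~ interval_splits D B.

(** Everything below happens on the product of the cosets of B through the
    coordinates of t. *)
Variables (k : nat) (t : k.-tuple gT).
Implicit Types (u : k.-tuple gT) (f : k.-tuple gT -> gT) (S T : {set 'I_k}).

Definition upd u (j : 'I_k) c := [tuple if i == j then c else tnth u i | i < k].

Lemma upd_tcls (I : ideal F) u v j c d : tcls I u v -> cls I c = cls I d ->
  tcls I (upd u j c) (upd v j d).
Proof. by move=> uv cd i; rewrite !tnth_mktuple; case: ifP. Qed.

Lemma upd_id u j : upd u j (tnth u j) = u.
Proof. by apply: eq_from_tnth => i; rewrite tnth_mktuple; case: eqP => [->|]. Qed.

Lemma upd_tcls_base u j c : tcls B u t -> cls B c = cls B (tnth t j) ->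
  tcls B (upd u j c) t.
Proof. by move=> ut ec i; rewrite tnth_mktuple; case: eqP => [->|]. Qed.

(** The base point t plays the role of zero. *)
Definition absorbing S f := forall j u, j \in S -> tcls B u t ->
  tnth u j = tnth t j -> f u \in D.

(** The list [es] holds the ideals that still have to be excluded from w, and
    each of them has its own absorbing coordinate. To remove e from the list,
    move the coordinate j reserved for it. Moving it within an ideal alpha not
    above e changes f by a function that absorbs at the other coordinates and
    has values in the meet of w and alpha, which is not above e; by induction
    the change is trivial modulo D. The ideals along which j can be moved
    freely are closed under joins, and if the largest one were not B, it would
    split the layer together with e. *)
Lemma absorbing_vanish (es : seq (ideal F)) S (w : ideal F) f :
  compatible F f -> absorbing S f -> size es <= #|S| ->
  (D <= w <= B)%O ->
  {in es, forall e : ideal F, D < e <= B}%O ->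
  (forall e : ideal F, (D < e <= B)%O -> e \notin es -> ~ (e <= w)%O) ->
  (forall u, tcls B u t -> f u \in w) ->
  forall u, tcls B u t -> f u \in D.
Proof.
elim: es S w f => [|e es IHes] S w f cf aS leS /andP[Dw wB] esP av fw.
  move: Dw; rewrite le_eqVlt => /predU1P[->//|Dw].
  by case: (av w) => //; rewrite Dw.
have /card_gt0P[j jS] : 0 < #|S| by apply: leq_ltn_trans leS.
have eDB : (D < e <= B)%O by apply: esP; rewrite mem_head.
pose P (delta : ideal F) := (D <= delta <= B)%O /\ forall u b y, tcls B u t ->
  b \in B -> y \in delta -> cls D (f (upd u j (tnth t j * (b * y)))) =
                     cls D (f (upd u j (tnth t j * b))).
have PD : P D.
  split=> [|u b y ut bB yD]; first by rewrite lexx.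
  by apply: cf; apply: upd_tcls => //; rewrite !clsM (cls_in yD) mulg1.
have tB b : b \in B -> cls B (tnth t j * b) = cls B (tnth t j).
  by move=> bB; rewrite clsM (cls_in bB) mulg1.
have [delta [_ [/andP[Ddel delB] Pdel] mdel]] := max_ideal PD.
have [edel u ut|nedel] := eqVneq delta B.
  pose b := (tnth t j)^-1 * tnth u j.
  have bB : b \in B by rewrite -cls_eq; apply/eqP/esym/ut.
  have := Pdel u 1 b ut (group1 _); rewrite edel bB mul1g mulKVg upd_id mulg1.
  move=> /(_ isT) e1; rewrite (cls_mem (lexx D) e1).
  apply: aS jS _ _; first exact: upd_tcls_base.
  by rewrite tnth_mktuple eqxx.
case: nonsplit; exists delta, e; rewrite !inE Ddel delB.
case/andP: (eDB) => De eB; rewrite eB (ltW De) lt_neqAle nedel delB; split=> //.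
move=> alpha; rewrite inE => /andP[Dal alB].
apply/orP; apply: contrapT => /negP; rewrite negb_or => /andP[nald neal].
have Pal u b y : tcls B u t -> b \in B -> y \in alpha ->
    cls D (f (upd u j (tnth t j * (b * y)))) = cls D (f (upd u j (tnth t j * b))).
  move=> ut bB yal; apply/esym/eqP; rewrite cls_eq.
  have byB : b * y \in B by rewrite groupM // (subsetP alB).
  (* The change of f caused by moving the coordinate j by y. *)
  pose g u := (f (upd u j (tnth t j * b)))^-1 * f (upd u j (tnth t j * (b * y))).
  apply: (IHes (S :\ j) (w `&` alpha)%O g) ut.
  - move=> I v v' vv'; rewrite !clsM !clsV.
    by congr (_^-1 * _); apply: cf; apply: upd_tcls.
  - move=> i v /setD1P[ij iS] vt ev; rewrite groupM ?groupV //.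
      by apply: (aS i) => //; [apply/upd_tcls_base/tB|rewrite tnth_mktuple (negPf ij)].
    by apply: (aS i) => //; [apply/upd_tcls_base/tB|rewrite tnth_mktuple (negPf ij)].
  - by move: leS; rewrite (cardsD1 j) jS.
  - by rewrite lexI Dw Dal leIx2 ?wB.
  - by move=> i ies; apply: esP; rewrite inE ies orbT.
  - move=> i iDB ies; rewrite lexI => /andP[iw ial].
    have [ei|ne] := eqVneq i e; first by rewrite -ei ial in neal.
    by apply: (av i) => //; rewrite inE negb_or ne.
  move=> v vt; rewrite inE; apply/andP; split.
    by rewrite groupM ?groupV //; apply/fw/upd_tcls_base/tB.
  rewrite -cls_eq; apply/eqP/cf/upd_tcls => //.
  by rewrite !clsM (cls_in yal) mulg1.
case: (mdel (delta `|` alpha)%O).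
  rewrite lt_neqAle leUl andbT; apply: contra nald => /eqP->; exact: leUr.
split; first by rewrite leUx delB alB lexUl ?Ddel.
move=> u b y ut bB; rewrite ideal_joinE => /mulsgP[y1 y2 y1d y2a ->].
rewrite (mulgA b) Pal ?Pdel // groupM //; exact: (subsetP delB).
Qed.

Definition restr T u := [tuple if j \in T then tnth u j else tnth t j | j < k].

Lemma restr_base T u : tcls B u t -> tcls B (restr T u) t.
Proof. by move=> ut j; rewrite !tnth_mktuple; case: ifP. Qed.

(** After resetting, at most N coordinates count, so that f becomes a
    composite of an N-ary compatible function with projections. *)
Lemma gen_restr S f : 0 < k -> compatible F f -> #|S| <= N ->
  gen F N (fun u => f (restr S u)).
Proof.
move=> k0 cf SN; have N0 : 0 < N by apply: leq_trans N_ge2.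
pose j0 := Ordinal k0.
pose s (j : 'I_k) : 'I_N := insubd (Ordinal N0) (index j (enum S)).
pose h (y : N.-tuple gT) := f [tuple if j \in S then tnth y (s j) else tnth t j | j < k].
pose g (i : 'I_N) u := tnth u (nth j0 (enum S) i).
apply: (@gen_ext _ _ _ _ (fun u => h [tuple g i u | i < N])) => [u|].
  congr f; apply: eq_from_tnth => j; rewrite !tnth_mktuple; case: ifP => // jS.
  rewrite /g val_insubd.
  have jS' : j \in enum S by rewrite mem_enum.
  by rewrite ifT ?nth_index //= (leq_trans _ SN) // cardE index_mem.
apply: gen_comp => // [|I y y' yy'|i]; [by rewrite N0 leqnn| |exact: gen_proj].
by apply: cf => j; rewrite !tnth_mktuple; case: ifP.
Qed.

(** Induction on the number of coordinates in T that are not known to be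
    absorbing. Such a coordinate j is handled by writing f as f1 * f0, where f0
    has the coordinate j reset and f1 absorbs at j. When all coordinates of T
    are absorbing, either there are few of them or f vanishes modulo D. *)
Lemma gen_local_absorbing T S f : 0 < k -> compatible F f -> S \subset T ->
  absorbing S f ->
  exists2 h, gen F N h &
    forall u, tcls B u t -> cls D (h u) = cls D (f (restr T u)).
Proof.
move=> k0; move: {2}_.+1 (ltnSn #|T :\: S|) => m.
elim: m T S f => // m IHm T S f ltm cf sST aS.
have [e0|/set0Pn[j /setDP[jT jS]]] := eqVneq (T :\: S) set0.
  have eST : T = S by apply/eqP; rewrite eqEsubset sST -setD_eq0 e0 eqxx.
  have [le|lt] := leqP #|{: ideal F}| #|S|; last first.
    exists (fun u => f (restr T u)) => //; rewrite eST.
    by apply: gen_restr => //; apply/ltnW/(leq_trans lt).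
  exists (fun _ => 1) => [|u ut]; first exact: gen_const.
  rewrite cls1 cls_in //.
  apply: (absorbing_vanish (es := [seq e <- enum {: ideal F} | (D < e <= B)%O]) (w := B)
    cf aS _ _ _ _ _ (restr_base _ ut)).
  - by rewrite (leq_trans _ le) // cardE size_filter count_size.
  - by rewrite leDB lexx.
  - by move=> e; rewrite mem_filter => /andP[].
  - by move=> e eDB; rewrite mem_filter eDB mem_enum.
  have /card_gt0P[j jS] : 0 < #|S|.
    by apply: leq_trans le; apply/card_gt0P; exists D.
  move=> v vt; have -> : (f v \in B) = (f (upd v j (tnth t j)) \in B).
    apply: cls_mem (lexx B) _; apply: cf; rewrite -{1}[v](upd_id v j).
    by apply: upd_tcls.
  apply: (subsetP leDB); apply: (aS j) => //; first exact: upd_tcls_base.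
  by rewrite tnth_mktuple eqxx.
pose f0 u := f (upd u j (tnth t j)).
pose f1 u := f u * (f0 u)^-1.
have cf0 : compatible F f0 by move=> I u v uv; apply/cf/upd_tcls.
have af0 : absorbing S f0.
  move=> i u iS ut ei; apply: (aS i) => //; first exact: upd_tcls_base.
  by rewrite tnth_mktuple; case: eqP jS => // <-; rewrite iS.
have [||||h0 gh0 h0E] := IHm (T :\ j) S f0 => //.
- rewrite -ltnS (leq_trans _ ltm) // ltnS [in X in _ < X](cardsD1 j) inE jT jS.
  by rewrite add1n ltnS subset_leq_card // setDDl setUC -setDDl.
- by rewrite subsetD1 sST.
have [||||h1 gh1 h1E] := IHm T (j |: S) f1 => //.
- rewrite -ltnS (leq_trans _ ltm) // ltnS [in X in _ < X](cardsD1 j) inE jT jS.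
  by rewrite add1n ltnS subset_leq_card // setDDl setUC.
- by move=> I u v uv; rewrite !clsM !clsV (cf I u v) // (cf0 I u v).
- by rewrite subUset sub1set jT.
- move=> i u /setU1P[->|iS] ut ei; last first.
  by apply: groupM; rewrite ?groupV; [exact: (aS i)|exact: (af0 i)].
  by rewrite /f1 /f0 -ei upd_id mulgV group1.
exists (fun u => h1 u * h0 u) => [|u ut]; first exact: gen_mul.
rewrite clsM h1E // h0E // /f1 clsM -mulgA clsV.
suff -> : f0 (restr (T :\ j) u) = f0 (restr T u) by rewrite mulVg mulg1.
congr f; apply: eq_from_tnth => i; rewrite !tnth_mktuple !inE.
by case: eqP.
Qed.

Lemma gen_local f : 0 < k -> compatible F f ->
  exists2 h, gen F N h & forall u, tcls B u t -> cls D (h u) = cls D (f u).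
Proof.
move=> k0 cf; have [||h gh hE] := @gen_local_absorbing setT set0 f k0 cf.
- exact: sub0set.
- by move=> j u; rewrite inE.
exists h => // u /hE->; congr (cls D (f _)).
by apply: eq_from_tnth => j; rewrite tnth_mktuple inE.
Qed.

End NonSplit.

(** * Finite generation from the layers *)

Section FiniteGeneration.
Local Open Scope group_scope.
Variables (gT : finGroupType) (F : opset gT).
Hypothesis F_expanded : expanded_group F.
(* One coordinate for each ideal, and at least binary operations. *)
Let N := #|{: ideal F}|.+2.

Lemma clone_compatible (G : opset gT) : (forall k (f : operation gT k), G k f -> compatible F f) ->
  forall k (f : operation gT k), clone_generated G f -> compatible F f.
Proof.
move=> cG k f; elim=> {k f} [k f /cG //|k i I u v uv|m k f g _ cf _ cg I u v uv].
  by rewrite !ffunE.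
by rewrite !ffunE; apply: cf => i; rewrite !tnth_mktuple; apply: cg.
Qed.

Lemma clone_generated_sub (G H : opset gT) k (f : operation gT k) :
  (forall m (g : operation gT m), G m g -> H m g) ->
  clone_generated G f -> clone_generated H f.
Proof.
move=> sGH; elim=> {k f} [k f /sGH|k i|m k f g _ cf _ cg].
- exact: Clone_gen.
- exact: Clone_proj.
exact: Clone_comp.
Qed.

Lemma gen_compatible k (f : k.-tuple gT -> gT) : gen F N f -> compatible F f.
Proof.
move=> /clone_compatible cf I u v uv.
have /(_ I u v uv) : compatible F [ffun x => f x].
  by apply: cf => m g [_ /congruence_preservingP[]].
by rewrite !ffunE.
Qed.

(** The selector of [gen_glue] in the two cases: with two ideals in the layer
    it may separate classes modulo D, but has to choose representatives modulo
    D for its values; otherwise it separates classes modulo B only and is the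
    identity on B in its second argument. *)
Lemma gen_layer (D B : ideal F) k (f : k.-tuple gT -> gT) :
  cuts D -> cuts B -> (D < B)%O ->
  lat_interval D B = [set D; B] \/ ~ interval_splits D B ->
  0 < k -> compatible F f -> (forall u, f u \in B) ->
  exists2 g, gen F N g & forall u, cls D (g u) = cls D (f u).
Proof.
move=> cD cB DB [two|nonsplit] k0 cf fB.
  have sp (I : ideal F) : (I <= D \/ B <= I)%O.
    have [|DI] := cD I; first by left.
    have [IB|] := cB I; last by right.
    have : I \in lat_interval D B by rewrite inE DI.
    by rewrite two !inE => /orP[]/eqP->; [left|right].
  pose m s x y := if (rep D x == s) && (y \in B) then rep D y else 1.
  apply: (@gen_glue _ _ _ N _ D B D m) => //; first exact: ltW.
  - move=> s I x x' y y' ex ey; rewrite /m.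
    have [ID|BI] := sp I.
      rewrite (rep_cls (cls_le ID ex)) (rep_cls (cls_le ID ey)).
      by rewrite (cls_mem (le_trans ID (ltW DB)) ey).
    have mB z w : (if (rep D z == s) && (w \in B) then rep D w else 1) \in B.
      case: ifP => // /andP[_ wB].
      by rewrite (cls_mem (ltW DB) (cls_rep D w)).
    by rewrite !cls_in // (subsetP BI).
  - by move=> s x y; rewrite /m; case: ifP; rewrite ?cls1 ?cls_rep.
  move=> t; exists (fun _ => f t); first exact: gen_const.
  by move=> u /cf.
pose m s x y := if (rep B x == s) && (y \in B) then y else 1 : gT.
apply: (@gen_glue _ _ _ N _ D B B m) => //; first exact: ltW.
- move=> s I x x' y y' ex ey; rewrite /m.
  have [IB|BI] := cB I.
    by rewrite (rep_cls (cls_le IB ex)) (cls_mem IB ey); case: ifP.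
  have mB z w : (if (rep B z == s) && (w \in B) then w else 1) \in B.
    by case: ifP => // /andP[].
  by rewrite !cls_in // (subsetP BI).
- by move=> s x y; rewrite /m; case: ifP; rewrite ?cls1.
move=> t; apply: (gen_local _ _ _ (ltW DB)) => //.
by rewrite /N ltnW.
Qed.

Lemma cut_layers_finitely_generated n (S_ : nat -> ideal F) :
  S_ 0 = [set 1] :> {set gT} -> S_ n = [set: gT] :> {set gT} ->
  (forall i, i < n -> (S_ i < S_ i.+1)%O) -> (forall i, i <= n -> cuts (S_ i)) ->
  (forall i, i < n -> lat_interval (S_ i) (S_ i.+1) = [set S_ i; S_ i.+1]
     \/ ~ interval_splits (S_ i) (S_ i.+1)) ->
  finitely_generated (congruence_preserving F).
Proof.
move=> S0 Sn Sinc Scut lay.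
have approx m : m <= n -> forall k (f : k.-tuple gT -> gT), 0 < k -> compatible F f ->
    exists2 g, gen F N g & forall u, cls (S_ (n - m)) (g u) = cls (S_ (n - m)) (f u).
  elim: m => [|m IHm] lemn k f k0 cf.
    exists (fun _ => 1) => [|u]; first exact: gen_const.
    by rewrite !cls_in // subn0 Sn inE.
  have [g gg gE] := IHm (ltnW lemn) k f k0 cf.
  have e : (n - m = (n - m.+1).+1)%N by rewrite subnSK.
  have lt : n - m.+1 < n by rewrite ltn_subrL /= (leq_trans _ lemn).
  pose f' u := (g u)^-1 * f u.
  have [|||||||h gh hE] := @gen_layer (S_ (n - m.+1)) (S_ (n - m)) k f'.
  - exact/Scut/leq_subr.
  - exact/Scut/leq_subr.
  - by rewrite e Sinc.
  - by rewrite e; apply: lay.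
  - by [].
  - move=> I u v uv; rewrite !clsM !clsV (cf I u v) //.
    by rewrite (gen_compatible gg uv).
  - by move=> u; rewrite -cls_eq gE.
  exists (fun u => g u * h u) => [|u]; first exact: gen_mul.
  by rewrite clsM hE !clsM clsV mulKVg.
pose T := {k : 'I_N.+1 & operation gT k}.
pose fwd (p : T) : {k : nat & operation gT k} := existT _ (val (tag p)) (tagged p).
pose s := [seq fwd p | p <- enum {: T} & `[< congruence_preserving F (tagged (fwd p)) >]].
have small_s k (f : operation gT k) : small_ops F N f -> opset_of_seq s f.
  move=> [kN cf]; have kN' : k < N.+1 by [].
  apply/mapP.
  exists (Tagged (fun k : 'I_N.+1 => operation gT k) (f : operation gT (Ordinal kN'))) => //.
  by rewrite mem_filter mem_enum andbT; apply/asboolP.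
exists s; split=> [k f /mapP[p]|k f].
  rewrite mem_filter => /andP[/asboolP cp _] e.
  pose Q (q : {k & operation gT k}) := congruence_preserving F (tagged q).
  by change (Q (Tagged (operation gT) f)); rewrite e.
move=> /congruence_preservingP[//|k0 cf].
have [g gg gE] := approx n (leqnn n) k f k0 cf.
apply: clone_generated_sub small_s _.
suff -> : f = [ffun x => g x] by [].
apply/ffunP=> u; rewrite ffunE.
have /eqP := gE u; rewrite cls_eq subnn S0 inE => /eqP e.
by apply/eqP; rewrite eq_sym eq_mulVg1 e.
Qed.

End FiniteGeneration.

(** * Covers and transposed intervals in an M2-free ideal lattice *)

Section IdealLattice.
Local Open Scope group_scope.
Local Open Scope order_scope.
Variables (gT : finGroupType) (F : opset gT).
Implicit Types (a b c I J K : ideal F).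

Lemma ideal_modular I J K : K <= I -> I `&` (J `|` K) <= (I `&` J) `|` K.
Proof.
move=> /subsetP KI; apply/subsetP=> x; rewrite ideal_meetE ideal_joinE.
move=> /setIP[xI]; rewrite ideal_joinE => /mulsgP[j k jJ kK ex].
rewrite ex mem_mulg // inE jJ andbT.
by rewrite -(groupMr _ (KI _ kK)) -ex.
Qed.

Definition covers a b := a < b /\ forall c, a <= c <= b -> c = a \/ c = b.

Lemma exists_cover a b : a < b -> exists2 c, a <= c & covers c b.
Proof.
move=> /(max_ideal (P := fun c => c < b))[c [ac cb mc]]; exists c => //; split=> // d.
case/andP=> cd db; have [->|nd] := eqVneq d b; first by right.
left; apply/eqP; rewrite eq_sym; apply: contrapT => /negP ncd.
by apply: (mc d); rewrite lt_neqAle ?ncd ?nd.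
Qed.

Lemma cover_join a b c : covers a b -> c <= b -> ~ c <= a -> c `|` a = b.
Proof.
move=> [ab cov] cb nca; case: (cov (c `|` a)) => [|ca|//].
  by rewrite leUr leUx cb ltW.
by case: nca; rewrite -ca leUl.
Qed.

Lemma cover_meet a b c : covers a b -> a <= c -> ~ b <= c -> b `&` c = a.
Proof.
move=> [ab cov] ac nbc; case: (cov (b `&` c)) => [|//|bc].
  by rewrite lexI ac leIl ltW.
by case: nbc; rewrite -bc leIr.
Qed.

Lemma cover_incomparable a1 a2 b : covers a1 b -> covers a2 b -> a1 != a2 -> ~ a1 <= a2.
Proof.
move=> [a1b cov1] [a2b _] /eqP ne le; case: (cov1 a2); first by rewrite le ltW.
  by move/esym.
by move=> e; rewrite e ltxx in a2b.
Qed.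

Hypothesis M2F : M2_free (ideal F).

(** Without a third element strictly between the meet of a1 and a2 and b, that
    interval would be isomorphic to M2; modularity then shows that a third
    element a3 forms a diamond with a1 and a2. *)
Lemma third_cover a1 a2 b : covers a1 b -> covers a2 b -> a1 != a2 ->
  exists a3, [/\ a3 <= b, a3 `|` a1 = b, a3 `|` a2 = b, a3 `&` a1 <= a2 & a3 `&` a2 <= a1].
Proof.
move=> cov1 cov2 ne.
have n12 := cover_incomparable cov1 cov2 ne.
have n21 : ~ a2 <= a1 by apply: cover_incomparable cov2 cov1 _; rewrite eq_sym.
have [a1b a2b] : a1 < b /\ a2 < b by case: cov1; case: cov2.
have j12 : a1 `|` a2 = b by apply: cover_join => //; apply: ltW.
have lub : a1 `&` a2 <= b by rewrite leIxl // ltW.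
have [[a3 [/andP[ua3 a3b] n3u n3b n31 n32]]|none] := pselect (exists c,
    [/\ a1 `&` a2 <= c <= b, c != a1 `&` a2, c != b, c != a1 & c != a2]); last first.
  case: (M2F lub).
  have [b1 b2] := (ltW a1b, ltW a2b).
  pose u := a1 `&` a2.
  have [u1 u2] : u <= a1 /\ u <= a2 by split; [apply: leIl|apply: leIr].
  pose g (x y : bool) := if x then if y then b else a1 else if y then a2 else u.
  have g1 x y : (a1 <= g x y) = x.
    case: x y => [] []; rewrite /g ?b1 ?lexx //; apply/negP=> // a1u.
    exact/n12/(le_trans a1u).
  have g2 x y : (a2 <= g x y) = y.
    case: x y => [] []; rewrite /g ?b2 ?lexx //; apply/negP=> // a2u.
    exact/n21/(le_trans a2u).
  exists (fun x : bool *p bool => g x.1 x.2); split.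
  - move=> [x1 x2] [y1 y2] e; have e' : g x1 x2 = g y1 y2 := e.
    by congr pair; [rewrite -(g1 x1 x2) e' g1|rewrite -(g2 x1 x2) e' g2].
  - move=> [x1 x2] [y1 y2]; change (g (x1 && y1) (x2 && y2) = g x1 x2 `&` g y1 y2).
    case: x1; case: x2; case: y1; case: y2; rewrite /g /= ?meetxx //.
    all: rewrite ?(meet_idPl b1) ?(meet_idPr b1) ?(meet_idPl b2) ?(meet_idPr b2)
      ?(meet_idPl u1) ?(meet_idPr u1) ?(meet_idPl u2) ?(meet_idPr u2)
      ?(meet_idPl lub) ?(meet_idPr lub) //.
    exact: meetC.
  - move=> [x1 x2] [y1 y2]; change (g (x1 || y1) (x2 || y2) = g x1 x2 `|` g y1 y2).
    case: x1; case: x2; case: y1; case: y2; rewrite /g /= ?joinxx //.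
    all: rewrite ?(join_idPl b1) ?(join_idPr b1) ?(join_idPl b2) ?(join_idPr b2)
      ?(join_idPl u1) ?(join_idPr u1) ?(join_idPl u2) ?(join_idPr u2)
      ?(join_idPl lub) ?(join_idPr lub) ?j12 //.
    by rewrite joinC j12.
  move=> c; split=> [|[[x y] <-]]; last first.
    change (g x y \in lat_interval u b); rewrite inE.
    by case: x; case: y; rewrite /g /= ?lexx ?lub ?u1 ?u2 ?b1 ?b2.
  rewrite inE => cub.
  have [->|nu] := eqVneq c u; first by exists (false, false).
  have [->|n1] := eqVneq c a1; first by exists (true, false).
  have [->|n2] := eqVneq c a2; first by exists (false, true).
  have [->|nb] := eqVneq c b; first by exists (true, true).
  by case: none; exists c.
(* The situation is symmetric in a1 and a2, here called x and y. *)
have key x y : covers x b -> covers y b -> x `&` y = a1 `&` a2 -> a3 != x ->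
    a3 `|` x = b /\ a3 `&` x <= y.
  move=> covx covy exy n3x.
  have nxa3 : ~ x <= a3.
    move=> xa3; case: covx => _ /(_ a3); rewrite xa3 a3b => -[//|e|e].
      by rewrite e eqxx in n3x.
    by rewrite e eqxx in n3b.
  have nw w : w <= a3 -> w <= x -> ~ w <= y -> False.
    move=> wa3 wx nwy; apply: nxa3; have yw : y `|` w = b.
      by rewrite joinC (cover_join covy) // (le_trans wa3).
    have := ideal_modular y wx; rewrite yw exy.
    have [xb _] := covx; rewrite (meet_idPl (ltW xb)) => /le_trans; apply.
    by rewrite leUx ua3.
  split; last first.
    apply: contrapT => nle; exact: (nw (a3 `&` x) (leIl _ _) (leIr _ _) nle).
  apply: cover_join => // a3x; apply: (nw a3) => // a3y.
  have : a3 <= a1 `&` a2 by rewrite -exy lexI a3x.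
  by move=> le; move/negP: n3u; apply; rewrite eq_le le.
have [j1 m1] := key a1 a2 cov1 cov2 erefl n31.
have [j2 m2] := key a2 a1 cov2 cov1 (meetC _ _) n32.
by exists a3.
Qed.

(** The next two lemmas are applied to centrality, but invariance under
    transposition of intervals is all that they use of it. *)
Variable P : ideal F -> ideal F -> Prop.
Hypothesis P_up : forall a b c, P a b -> P (a `|` c) (b `|` c).
Hypothesis P_down : forall b c d, b <= d -> P c d -> P (b `&` c) b.

(** In a diamond, the interval from a1 to b is transposed down to the one
    below a3, and that one up to the interval from a2 to b. *)
Lemma cover_transfer a1 a2 b : covers a1 b -> covers a2 b -> P a1 b -> P a2 b.
Proof.
move=> cov1 cov2 P1; have [<- //|ne] := eqVneq a1 a2.
have [a3 [a3b j1 j2 m1 m2]] := third_cover cov1 cov2 ne.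
have := P_up a2 (P_down a3b P1).
by rewrite j2 (join_idPr m1).
Qed.

Variables D B : ideal F.
Hypotheses (cutD : cuts D) (cutB : cuts B).
Hypothesis no_cut : forall c, D < c < B -> ~ cuts c.

(** Let b0 be maximal among the ideals of the layer with a lower cover
    violating P; by [cover_transfer] all lower covers of b0 violate it. Then b0
    cuts the lattice: for x incomparable to b0, take a lower cover a0 of b0
    above the meet of b0 and x, and a lower cover c' of the join of b0 and x
    above both a0 and x. By maximality of b0 the interval
    from c' to that join satisfies P, and it transposes down to the one from a0
    to b0. *)
Lemma covers_transposed a b : (forall a, D <= a -> covers a B -> P a B) ->
  D <= a -> covers a b -> b <= B -> P a b.
Proof.
move=> top Da cab bB; apply: contrapT => nP.
pose bad b := b <= B /\ exists a, [/\ D <= a, covers a b & ~ P a b].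
have /max_ideal[{Da cab bB nP}a0 [_ [a0B [a' [Da' cov' nP']]] mx]] : bad b by split=> //; exists a.
rename a0 into b0.
have nb0B : b0 != B by apply: contra_notN nP' => /eqP eb; rewrite eb in cov' *; apply: top.
have [a'b _] := cov'.
case: (no_cut (c := b0)); first by rewrite (le_lt_trans Da' a'b) lt_neqAle nb0B.
move=> x; apply/orP; apply: contrapT => /negP; rewrite negb_or => /andP[nxb nbx].
have Dx : D <= x.
  have [xD|//] := cutD x; by rewrite (le_trans xD (le_trans Da' (ltW a'b))) in nxb.
have xB : x <= B.
  by have [//|/(le_trans a0B) bx] := cutB x; rewrite bx in nbx.
have [a0 la0 cov0] : exists2 a, b0 `&` x <= a & covers a b0.
  apply: exists_cover; rewrite lt_neqAle leIl andbT.
  by apply: contra nbx => /eqP <-; apply: leIr.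
have Da0 : D <= a0 by apply: le_trans la0; rewrite lexI Dx (le_trans Da' (ltW a'b)).
apply: nP'; apply: (cover_transfer cov0) => //.
have [a0b _] := cov0.
pose c := b0 `|` x.
have bc : b0 < c.
  by rewrite lt_neqAle leUl andbT; apply: contra nxb => /eqP->; apply: leUr.
have a0xc : a0 `|` x < c.
  rewrite lt_neqAle leU2 ?(ltW a0b) // andbT; apply/eqP=> e.
  have := ideal_modular x (ltW a0b); rewrite [x `|` _]joinC e (meet_idPl (ltW bc)).
  by rewrite (join_idPr la0) => /(lt_le_trans a0b); rewrite ltxx.
have [c' lc' covc] := exists_cover a0xc.
have a0c' : a0 <= c' by apply: le_trans lc'; apply: leUl.
have xc' : x <= c' by apply: le_trans lc'; apply: leUr.
have nbc : ~ b0 <= c'.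
  move=> bc'; have [] := covc; rewrite lt_neqAle => /andP[/eqP ne le] _.
  by apply: ne; apply/eqP; rewrite eq_le le leUx bc'.
rewrite -(cover_meet cov0 a0c' nbc); apply: P_down (ltW bc) _.
apply: contrapT => nPc; apply: (mx c bc); split; first by rewrite leUx a0B.
by exists c'; split=> //; apply: le_trans a0c'.
Qed.

End IdealLattice.

(** * Central intervals *)

Section Centrality.
Local Open Scope group_scope.
Variables (gT : finGroupType) (F : opset gT).
Hypothesis F_expanded : expanded_group F.
Variable B : ideal F.
Implicit Types (a b c d I : ideal F).

Definition tmul k (x z : k.-tuple gT) := [tuple tnth x j * tnth z j | j < k].

Lemma tmul_tcls I k (x x' z z' : k.-tuple gT) : tcls I x x' -> tcls I z z' ->
  tcls I (tmul x z) (tmul x' z').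
Proof. by move=> ex ez j; rewrite !tnth_mktuple !clsM ex ez. Qed.

Lemma tmulA k (x y z : k.-tuple gT) : tmul x (tmul y z) = tmul (tmul x y) z.
Proof. by apply: eq_from_tnth => j; rewrite !tnth_mktuple mulgA. Qed.

Lemma tmul_in I k (x z : k.-tuple gT) : (forall j, tnth z j \in I) -> tcls I (tmul x z) x.
Proof. by move=> zI j; rewrite !tnth_mktuple clsM (cls_in (zI j)) mulg1. Qed.

Definition incr k (f : k.-tuple gT -> gT) x z := (f x)^-1 * f (tmul x z).

(** The term condition saying that the commutator of B and b, taken with
    respect to all compatible functions, lies in a. *)
Definition central a b := forall k (f : k.-tuple gT -> gT), compatible F f ->
  forall x y z, tcls B x y -> (forall j, tnth z j \in b) ->
  cls a (incr f x z) = cls a (incr f y z).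

Lemma incr_cls I k (f : k.-tuple gT -> gT) x z z' : compatible F f -> tcls I z z' ->
  cls I (incr f x z) = cls I (incr f x z').
Proof. by move=> cf zz; rewrite !clsM; congr (_ * _); apply/cf/tmul_tcls. Qed.

Lemma incr_in I k (f : k.-tuple gT -> gT) x z : compatible F f ->
  (forall j, tnth z j \in I) -> incr f x z \in I.
Proof. by move=> cf zI; rewrite -cls_eq; apply/eqP/esym/cf/tmul_in. Qed.

Lemma ideal_join_factor a c k (z : k.-tuple gT) : (forall j, tnth z j \in (a `|` c)%O) ->
  exists u v : k.-tuple gT,
    [/\ z = tmul u v, forall j, tnth u j \in a & forall j, tnth v j \in c].
Proof.
move=> zac.
have /fin_all_exists[u uP] j : exists u, u \in a /\ u^-1 * tnth z j \in c.
  have := zac j; rewrite ideal_joinE => /mulsgP[u v ua vc ->].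
  by exists u; rewrite mulKg.
exists [tuple u j | j < k], [tuple (u j)^-1 * tnth z j | j < k].
split=> [|j|j]; rewrite ?tnth_mktuple; try by case: (uP j).
by apply: eq_from_tnth => j; rewrite !tnth_mktuple mulKVg.
Qed.

Lemma central_up a b c : central a b -> central (a `|` c)%O (b `|` c)%O.
Proof.
move=> cab k f cf x y z xy /ideal_join_factor[u [v [-> ub vc]]].
have drop w : cls (a `|` c)%O (incr f w (tmul u v)) = cls (a `|` c)%O (incr f w u).
  by apply: (cls_le (leUr c a)); apply/incr_cls/tmul_in.
by rewrite !drop; apply: cls_le (leUl a c) _; apply: cab.
Qed.

Lemma central_down b c d : (b <= d)%O -> central c d -> central (b `&` c)%O b.
Proof.
move=> /subsetP bd ccd k f cf x y z xy zb; apply/eqP; rewrite cls_eq inE.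
rewrite groupM ?groupV ?incr_in //= -cls_eq; apply/eqP/ccd => // j; exact/bd/zb.
Qed.

(** Moving first by z does not change the class modulo B of the base point of
    the second increment. *)
Lemma incr_additive a b k (f : k.-tuple gT -> gT) x z z' : (b <= B)%O -> central a b ->
  compatible F f -> (forall j, tnth z j \in b) -> (forall j, tnth z' j \in b) ->
  cls a (incr f x (tmul z z')) = cls a (incr f x z) * cls a (incr f x z').
Proof.
move=> /subsetP bB cab cf zb z'b.
have -> : incr f x (tmul z z') = incr f x z * incr f (tmul x z) z'.
  by rewrite /incr tmulA mulgA mulgK.
rewrite clsM; congr (_ * _); apply: cab => //; apply: tmul_in => j; exact/bB/zb.
Qed.

(** Centrality applied to the group multiplication. *)
Lemma central_commute a b u v : central a b -> u \in b -> v \in B ->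
  cls a (u * v) = cls a (v * u).
Proof.
move=> cab ub vB; pose f (t : 2.-tuple gT) := tnth t ord0 * tnth t ord_max.
have cf : compatible F f by move=> I x y xy; rewrite !clsM !xy.
have := cab _ f cf [tuple 1; 1] [tuple 1; v] [tuple u; 1].
rewrite /incr /f !tnth_mktuple !(tnth_nth 1) /= !mulg1 !mul1g invg1 mul1g => e.
rewrite [RHS]clsM e ?clsM ?clsV ?mulKVg //.
  by case=> [[|[|//]] lti]; rewrite !(tnth_nth 1) //= cls1 (cls_in vB).
by case=> [[|[|//]] lti]; rewrite !(tnth_nth 1) //=.
Qed.

(** Modulo m1, directions in B may be taken in m2 and displacements of the base
    point in m3. A mixed difference of f in such directions lies in both m2 and
    m3, hence in m1. *)
Lemma central_top m1 m2 m3 : (m2 `|` m1 = B)%O -> (m3 `|` m1 = B)%O ->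
  (m3 `&` m2 <= m1)%O -> central m1 B.
Proof.
move=> j2 j3 m23 k f cf x y z xy; rewrite -{1}j2 => /ideal_join_factor[z2 [z1 [-> z2m z1m]]].
have drop w : cls m1 (incr f w (tmul z2 z1)) = cls m1 (incr f w z2).
  by apply/incr_cls/tmul_in.
rewrite !drop {drop}; pose w := [tuple (tnth x j)^-1 * tnth y j | j < k].
have ey : y = tmul x w by apply: eq_from_tnth => j; rewrite !tnth_mktuple mulKVg.
have wB j : tnth w j \in (m3 `|` m1)%O by rewrite j3 tnth_mktuple -cls_eq xy.
have [w3 [w1 [ew w3m w1m]]] := ideal_join_factor wB.
have -> : cls m1 (incr f y z2) = cls m1 (incr f (tmul x w3) z2).
  have yx : tcls m1 y (tmul x w3) by rewrite ey ew tmulA; apply: tmul_in.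
  rewrite !clsM !clsV (cf m1 _ _ yx); congr (_ * _).
  by apply/cf/tmul_tcls.
apply: (cls_le m23); apply/eqP; rewrite cls_eq inE; apply/andP; split.
  rewrite -cls_eq !clsM !clsV; apply/eqP; congr (_^-1 * _); apply: cf.
    by move=> j; rewrite (tmul_in x w3m).
  by apply: tmul_tcls => // j; rewrite (tmul_in x w3m).
by rewrite groupM ?groupV ?incr_in.
Qed.

Definition pcentral p a b := central a b /\ forall x, x \in b -> x ^+ p \in a.

Lemma pcentral_up p a b c : pcentral p a b -> pcentral p (a `|` c)%O (b `|` c)%O.
Proof.
move=> [cab pab]; split=> [|x]; first exact: central_up.
rewrite {1}ideal_joinE => /mulsgP[u v ub vc ->].
rewrite -cls_eq1 clsX clsM (cls_in (subsetP (leUr c a) _ vc)) mulg1 -clsX cls_eq1.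
exact: subsetP (leUl a c) _ (pab _ ub).
Qed.

Lemma pcentral_down p b c d : (b <= d)%O -> pcentral p c d -> pcentral p (b `&` c)%O b.
Proof.
move=> bd [ccd pcd]; split=> [|x xb]; first exact: central_down ccd.
by rewrite inE groupX // pcd // (subsetP bd).
Qed.

Lemma incr_expg a b k (f : k.-tuple gT -> gT) x z m : (b <= B)%O -> central a b ->
  compatible F f -> (forall j, tnth z j \in b) ->
  cls a (incr f x [tuple tnth z j ^+ m | j < k]) = cls a (incr f x z) ^+ m.
Proof.
move=> bB cab cf zb; elim: m => [|m IHm].
  rewrite expg0; apply/cls_in/incr_in => // j.
  by rewrite tnth_mktuple expg0 group1.
rewrite expgSr -IHm -(incr_additive x bB cab cf _ zb) => [|j].
  by congr (cls a (incr f x _)); apply: eq_from_tnth => j; rewrite !tnth_mktuple expgSr.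
by rewrite tnth_mktuple groupX.
Qed.

(** Increments are additive, so the elements of B whose p-th power lies in m
    form an ideal. For a prime p dividing the order of B / m it is larger than m
    by the theorem of Cauchy, hence equal to B. *)
Lemma cover_exponent m : covers m B -> central m B ->
  exists2 p, prime p & pcentral p m B.
Proof.
move=> [mB cov] cmB; have [lemB nBm] : (m <= B)%O /\ ~ (B <= m)%O.
  by split; [apply: ltW|move/(lt_le_trans mB); rewrite ltxx].
have nNm (A : {set gT}) : A \subset 'N(m) by apply/subsetP => x _; apply: ideal_norm.
have Q1 : 1 < #|(B / m)%g|.
  by rewrite cardG_gt1 -subG1 quotient_sub1 //; apply/negP.
pose p := pdiv #|(B / m)%g|; have p_pr : prime p := pdiv_prime Q1.
exists p => //; split=> //.
pose alpha x y := (x^-1 * y \in B) && ((x^-1 * y) ^+ p \in m).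
have [I Ialpha] : exists I : ideal F, forall x y, alpha x y = (cls I x == cls I y).
  apply: congruence_ideal => //; split.
  - by move=> x; rewrite /alpha mulVg expg1n !group1.
  - move=> x y; rewrite /alpha -(groupV B) -(groupV m) -expgVn.
    by rewrite invMg invgK.
  - move=> y x z /andP[xyB xym] /andP[yzB yzm].
    have e : x^-1 * z = (x^-1 * y) * (y^-1 * z) by rewrite mulgA mulgK.
    rewrite /alpha e groupM //= -cls_eq1 clsX clsM expgMn -?clsX.
      by rewrite (cls_in xym) (cls_in yzm) mulg1.
    by rewrite /commute -!clsM (central_commute cmB).
  move=> k f Ff x y xy.
  pose i := [tuple (tnth x j)^-1 * tnth y j | j < k].
  have iB j : tnth i j \in B by rewrite tnth_mktuple; case/andP: (xy j).
  have cf := fundamental_compatible Ff.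
  have -> : y = tmul x i by apply: eq_from_tnth => j; rewrite !tnth_mktuple mulKVg.
  apply/andP; split; first exact: incr_in.
  rewrite -cls_eq1 clsX -(incr_expg _ _ (lexx B) cmB) // cls_eq1; apply: incr_in => // j.
  by rewrite !tnth_mktuple; case/andP: (xy j).
have IE x : (x \in I) = (x \in B) && (x ^+ p \in m).
  by rewrite -cls_eq1 -(cls1 I) eq_sym -Ialpha /alpha invg1 mul1g.
suff eI : I = B by move=> x; rewrite -{1}eI IE => /andP[].
have [|eI|//] := cov I.
  rewrite !ideal_leE; apply/andP; split; apply/subsetP=> x; rewrite IE; last by case/andP.
  by move=> xm; rewrite groupX // (subsetP lemB).
have [_ /morphimP[y _ yB ->] oy] := Cauchy p_pr (pdiv_dvd #|(B / m)%g|).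
have yp : cls m y ^+ p = 1 by rewrite -oy expg_order.
have : y \in I by rewrite IE yB -cls_eq1 clsX yp eqxx.
rewrite eI -cls_eq1 /cls -order_eq1 oy => /eqP e1; by rewrite e1 in p_pr.
Qed.

End Centrality.

(** * Functions of low degree on the discrete cube *)

Section LowDegree.
Import GRing.Theory.
Local Open Scope ring_scope.
Variables (R : comNzRingType) (n : nat).
Implicit Types (Y T : {set 'I_n}) (q : {set 'I_n} -> R).

(** A subset Y of the index set stands for the vertex of the discrete cube with
    the coordinates in Y equal to 1. Functions of degree at most d are sums of
    functions that depend on at most d coordinates; this is the same as being
    represented by a polynomial of degree at most d, but products and
    composites need no manipulation of coefficients. *)
Inductive lowdeg (d : nat) : ({set 'I_n} -> R) -> Prop :=
| lowdeg_junta T q : (#|T| <= d)%N -> (forall Y, q Y = q (Y :&: T)) -> lowdeg d q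
| lowdeg_sum q1 q2 q : lowdeg d q1 -> lowdeg d q2 ->
    (forall Y, q Y = q1 Y + q2 Y) -> lowdeg d q.

Lemma lowdeg_const d c : lowdeg d (fun _ => c).
Proof. by apply: (@lowdeg_junta _ set0); rewrite ?cards0. Qed.

Lemma lowdeg_ext d q q' : (forall Y, q' Y = q Y) -> lowdeg d q -> lowdeg d q'.
Proof.
by move=> e lq; apply: lowdeg_sum lq (lowdeg_const d 0) _ => Y; rewrite addr0 e.
Qed.

Lemma lowdegD d q q' : lowdeg d q -> lowdeg d q' -> lowdeg d (fun Y => q Y + q' Y).
Proof. by move=> lq lq'; apply: lowdeg_sum lq lq' _. Qed.

Lemma lowdeg_le d e q : (d <= e)%N -> lowdeg d q -> lowdeg e q.
Proof.
move=> de; elim=> {q} [T q Td qT|q1 q2 q _ l1 _ l2 eq].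
  by apply: (@lowdeg_junta _ T) => //; apply: leq_trans de.
exact: lowdeg_sum l1 l2 eq.
Qed.

Lemma lowdegM d e q q' : lowdeg d q -> lowdeg e q' -> lowdeg (d + e) (fun Y => q Y * q' Y).
Proof.
elim=> {q} [T q Td qT|q1 q2 q _ l1 _ l2 eq] l'; last first.
  by apply: lowdeg_sum (l1 l') (l2 l') _ => Y; rewrite eq mulrDl.
elim: l' => {q'} [T' q' Td' qT'|q1 q2 q' _ l1 _ l2 eq]; last first.
  by apply: lowdeg_sum l1 l2 _ => Y; rewrite eq mulrDr.
apply: (@lowdeg_junta _ (T :|: T')) => [|Y].
  by apply: leq_trans (leq_add Td Td'); rewrite cardsU leq_subr.
rewrite [q (_ :&: _)]qT [q' (_ :&: _)]qT' -!setIA.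
by rewrite (setIidPr (subsetUl T T')) (setIidPr (subsetUr T T')) -qT -qT'.
Qed.

Lemma lowdeg_bigsum d (I : Type) (r : seq I) (q : I -> {set 'I_n} -> R) :
  (forall i, lowdeg d (q i)) -> lowdeg d (fun Y => \sum_(i <- r) q i Y).
Proof.
move=> lq; elim: r => [|i r IHr].
  by apply: lowdeg_ext (lowdeg_const d 0) => Y; rewrite big_nil.
by apply: lowdeg_ext (lowdegD (lq i) IHr) => Y; rewrite big_cons.
Qed.

Lemma lowdeg_bigprod d (I : finType) (q : I -> {set 'I_n} -> R) :
  (forall i, lowdeg d (q i)) -> lowdeg (#|I| * d) (fun Y => \prod_i q i Y).
Proof.
move=> lq; have -> : #|I| = size (index_enum I) by rewrite cardT enumT.
elim: (index_enum I) => [|i r IHr].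
  by apply: lowdeg_ext (lowdeg_const _ 1) => Y; rewrite big_nil.
by apply: lowdeg_ext (lowdegM (lq i) IHr) => Y; rewrite big_cons.
Qed.

(** Up to sign, the alternating sum is the coefficient of the product of all
    variables. A function independent of the coordinate i contributes
    nothing, since the vertices Y and i |: Y cancel. *)
Lemma lowdeg_alternating d q : (d < n)%N -> lowdeg d q ->
  \sum_(Y : {set 'I_n}) (-1) ^+ #|Y| * q Y = 0.
Proof.
move=> dn; elim=> {q} [T q Td qT|q1 q2 q _ e1 _ e2 eq]; last first.
  by under eq_bigr do rewrite eq mulrDr; rewrite big_split /= e1 e2 addr0.
have /subsetPn[i _ iT] : ~~ ([set: 'I_n] \subset T).
  by apply/negP=> /subset_leq_card; rewrite cardsT card_ord leqNgt (leq_ltn_trans Td).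
rewrite (bigID (fun Y : {set 'I_n} => i \in Y)) /=.
rewrite (reindex_onto (fun Y => i |: Y) (fun Y => Y :\ i)) /=; last first.
  by move=> Y iY; rewrite setD1K.
rewrite (eq_bigl (fun Y : {set 'I_n} => i \notin Y)) => [|Y]; last first.
  rewrite setU11 /=; apply/eqP/idP => [<-|iY]; first by rewrite setD11.
  by rewrite setU1K.
rewrite -big_split big1 //= => Y iY.
rewrite cardsU1 iY add1n exprS mulN1r mulNr [q (_ |: _)]qT [q Y]qT.
suff -> : (i |: Y) :&: T = Y :&: T by rewrite addNr.
by rewrite setIUl (_ : [set i] :&: T = set0) ?set0U //; apply/eqP; rewrite setI_eq0 disjoints1.
Qed.

End LowDegree.

(** * Degree bounds for generated functions *)

Section CubeDegree.
Local Open Scope group_scope.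
Variables (gT : finGroupType) (F : opset gT).
Hypothesis F_expanded : expanded_group F.
Variables (B : ideal F) (p : nat).
Hypothesis p_pr : prime p.
Implicit Types (a b c I : ideal F).
Local Notation Fp := 'F_p.
Local Notation cube n := {set 'I_n}.

Definition invariant I k (phi : k.-tuple gT -> Fp) :=
  forall u v, tcls I u v -> phi u = phi v.

Definition cls_fun I (phi : gT -> Fp) := forall x y, cls I x = cls I y -> phi x = phi y.

(** The degree of a map into the group, considered modulo I. Testing against all
    functions on the quotient avoids any choice of coordinates. *)
Definition degree_le I d n (g : cube n -> gT) :=
  forall phi, cls_fun I phi -> lowdeg d (fun Y => phi (g Y)).

(** Expand phi as a combination of the products of indicator functions of
    single classes; each factor depends on one g i only. *)
Lemma degree_le_tuple I d n k (g : 'I_k -> cube n -> gT) phi :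
  (forall i, degree_le I d (g i)) -> invariant I phi ->
  lowdeg (k * d) (fun Y => phi [tuple g i Y | i < k]).
Proof.
move=> dg inv.
apply: (@lowdeg_ext _ _ _ (fun Y => \sum_(t : k.-tuple gT)
   (phi t * \prod_(i < k) (rep I (g i Y) == tnth t i)%:R))%R) => [Y|]; last first.
  apply: lowdeg_bigsum => t; apply: (lowdegM (d := 0) (e := (k * d)%N)); first exact: lowdeg_const.
  rewrite -[X in (X * d)%N]card_ord; apply: lowdeg_bigprod => i.
  apply: (dg i (fun x => (rep I x == tnth t i)%:R)%R) => x y e.
  by rewrite (rep_cls e).
pose t0 := [tuple rep I (g i Y) | i < k].
rewrite (bigD1 t0) //= [X in (_ * X + _)%R]big1 => [|i _]; last by rewrite tnth_mktuple eqxx.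
rewrite [X in (_ + X)%R]big1 ?GRing.addr0 ?GRing.mulr1 => [|t nt].
  by apply: inv => i; rewrite !tnth_mktuple cls_rep.
have [i ni] : exists i, rep I (g i Y) != tnth t i.
  apply: contrapT => no; case/eqP: nt; apply: eq_from_tnth => i.
  rewrite tnth_mktuple; apply/eqP; apply: contrapT => /negP ni; apply: no.
  by exists i; rewrite eq_sym.
by rewrite (bigD1 i) //= (negPf ni) GRing.mul0r GRing.mulr0.
Qed.

(** The linear functionals on the section [c / a], extended arbitrarily
    outside c. *)
Definition functional a c (l : gT -> Fp) :=
  (forall u v, u \in c -> v \in c -> l (u * v) = (l u + l v)%R) /\
  (forall u, u \in a -> l u = 0%R).

Lemma functional_cls a c l u v : functional a c l -> (a <= c)%O -> u \in c ->
  cls a u = cls a v -> l u = l v.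
Proof.
move=> [lM l0] ac uc e; have va : u^-1 * v \in a by rewrite -cls_eq e.
by rewrite -[in RHS](mulKVg u v) lM ?(l0 _ va) ?GRing.addr0 // (subsetP ac).
Qed.

(** The section [c / a] is elementary abelian, thus a row space over the field
    with p elements, and the coordinates separate its points. *)
Lemma functional_separates a c u : pcentral B p a c -> (a <= c)%O -> (c <= B)%O ->
  u \in c -> u \notin a -> exists2 l, functional a c l & l u != 0%R.
Proof.
move=> [cac pac] ac cB uc ua.
have memE x : x \in c -> cls a x \in (c / a)%g.
  by move=> xc; apply: mem_morphim => //; apply: ideal_norm.
have abelE : p.-abelem (c / a)%g.
  rewrite abelemE //; apply/andP; split.
    apply/centsP=> _ /morphimP[x _ xc ->] _ /morphimP[y _ yc ->].
    rewrite /commute -!/(cls a _) -!clsM; apply: central_commute cac _ _ => //.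
    exact: subsetP cB _ yc.
  apply/exponentP=> _ /morphimP[x _ xc ->].
  by rewrite -/(cls a x) -clsX cls_in // pac.
have ntE : (c / a)%G != 1%G.
  apply/trivgPn; exists (cls a u); first exact: memE.
  by rewrite cls_eq1.
pose r := abelem_rV abelE ntE (cls a u).
have [j rj] : exists j, r ord0 j != 0%R.
  apply: contrapT => no; have : r == 0%R.
    apply/eqP/rowP => j; rewrite mxE; apply/eqP; apply: contrapT => /negP nj.
    by apply: no; exists j.
  rewrite -(abelem_rV_1 abelE ntE) (inj_in_eq (abelem_rV_inj (ntE := ntE))) ?group1 ?memE //.
  by rewrite cls_eq1 (negPf ua).
exists (fun x => abelem_rV abelE ntE (cls a x) ord0 j) => //.
split=> [x y xc yc|x xa]; last by rewrite (cls_in xa) abelem_rV_1 mxE.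
by rewrite clsM abelem_rV_M ?memE // mxE.
Qed.

Let M := #|{: {ffun gT -> Fp} * Fp}|.

(** Every function on [c / a] is a polynomial in the functionals: Q v is the
    product of all l - d with l a functional and d a scalar different from
    l v, so it vanishes exactly outside the class of v. The number M of
    possible factors bounds its degree. *)
Lemma lowdeg_of_functionals a c n (z : cube n -> gT) E chi : pcentral B p a c ->
  (a <= c)%O -> (c <= B)%O -> (forall Y, z Y \in c) ->
  (forall l, functional a c l -> lowdeg E (fun Y => l (z Y))) ->
  cls_fun a chi -> lowdeg (M * E) (fun Y => chi (z Y)).
Proof.
move=> pc ac cB zc lE inv.
pose Q (v w : gT) : Fp := (\prod_(i : {ffun gT -> Fp} * Fp)
  (if `[< functional a c i.1 >] && (i.1 v != i.2) then i.1 w - i.2 else 1))%R.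
have Qv v : Q v v != 0%R.
  apply/GRing.prodf_neq0 => i _; case: ifP => [/andP[_ ne]|_]; last exact: GRing.oner_neq0.
  by rewrite GRing.subr_eq0.
have Qw v w : v \in c -> w \in c -> cls a v != cls a w -> Q v w = 0%R.
  move=> vc wc; rewrite cls_eq => nvw.
  have [|l fl ne] := functional_separates pc ac cB _ nvw; first by rewrite groupM ?groupV.
  pose l' : {ffun gT -> Fp} := [ffun x => l x].
  have el : l' = l :> (gT -> Fp) by apply/funext=> x; rewrite ffunE.
  apply/eqP/GRing.prodf_eq0; exists (l', l w) => //=.
  rewrite el asboolT //= ifT ?GRing.subrr //.
  have [lM _] := fl; apply: contra ne => /eqP e.
  have : l w = (l v + l (v^-1 * w)%g)%R by rewrite -lM ?mulKVg // groupM ?groupV.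
  by rewrite e -{1}[l w]GRing.addr0 => /GRing.addrI <-.
have Qcls v w w' : w \in c -> cls a w = cls a w' -> Q v w = Q v w'.
  move=> wc e; apply: eq_bigr => i _; case: ifP => // /andP[/asboolP fi _].
  by rewrite (functional_cls fi ac wc e).
apply: (@lowdeg_ext _ _ _ (fun Y => \sum_(v : gT)
   (if (rep a v == v) && (v \in c) then chi v / Q v v else 0) * Q v (z Y))%R) => [Y|]; last first.
  apply: lowdeg_bigsum => v; apply: (lowdegM (d := 0) (e := (M * E)%N)); first exact: lowdeg_const.
  apply: lowdeg_bigprod => i.
  case: (boolP (`[< functional a c i.1 >] && (i.1 v != i.2)));
    last by move=> _; exact: lowdeg_const.
  move=> /andP[/asboolP fi _].
  by apply: lowdeg_ext (lowdegD (lE _ fi) (lowdeg_const n E (- i.2)%R)) => Y.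
have v0c : rep a (z Y) \in c by rewrite (cls_mem ac (cls_rep a (z Y))).
have v0r : rep a (rep a (z Y)) = rep a (z Y) by apply/rep_cls/cls_rep.
rewrite (bigD1 (rep a (z Y))) //= v0r eqxx v0c /=.
rewrite big1 ?GRing.addr0 => [|v nv].
  rewrite (Qcls _ (z Y) (rep a (z Y))) ?cls_rep // GRing.mulfVK //.
  by apply: inv; rewrite cls_rep.
case: ifP => [/andP[/eqP rv vc]|_]; last by rewrite GRing.mul0r.
rewrite (Qw v (z Y)) ?zc ?GRing.mulr0 //; apply: contra nv => /eqP e.
by rewrite -rv (rep_cls e).
Qed.

Section Terms.
Variables (G : opset gT) (N : nat) (b0 : gT).
Hypothesis G_compatible : forall k (f : operation gT k), G f -> compatible F f.
Hypothesis G_arity : forall k (f : operation gT k), G f -> k <= N.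
Hypothesis b0B : b0 \in B.

(** The functions on the cube obtained by evaluating composites of members of G
    at arguments that are 1 or b0. Here compositions are built from single
    members of G outwards, which is what induction on degrees requires. *)
Inductive term n : (cube n -> gT) -> Prop :=
| term_var i : term (fun Y => if i \in Y then b0 else 1)
| term_app k (f : operation gT k) (g : 'I_k -> cube n -> gT) : G f ->
    (forall i, term (g i)) -> term (fun Y => f [tuple g i Y | i < k]).

Lemma clone_term n k (f : operation gT k) (g : 'I_k -> cube n -> gT) :
  clone_generated G f -> (forall i, term (g i)) -> term (fun Y => f [tuple g i Y | i < k]).
Proof.
move=> gf; elim: gf g => {k f} [k f Gf|k i|m k f h _ IHf _ IHh] g tg.
- exact: term_app.
- have -> : (fun Y => proj_op gT i [tuple g i0 Y | i0 < k]) = g i; last exact: tg.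
  by apply/funext=> Y; rewrite ffunE tnth_mktuple.
have -> : (fun Y => comp_op f h [tuple g i Y | i < k]) =
    (fun Y => f [tuple (fun j Y => h j [tuple g i Y | i < k]) j Y | j < m]).
  by apply/funext=> Y; rewrite ffunE.
by apply: IHf => j; apply: IHh.
Qed.

Lemma term_base n (g : cube n -> gT) : term g -> forall Y Y', cls B (g Y) = cls B (g Y').
Proof.
elim=> [i Y Y'|k f h Gf _ IH Y Y'].
  by do 2!case: ifP => _; rewrite // cls1 (cls_in b0B).
by apply: G_compatible => // i; rewrite !tnth_mktuple.
Qed.

(** Additivity of the increment, one coordinate of the direction at a time. *)
Lemma incr_functional a c l k (f : k.-tuple gT -> gT) x (z : k.-tuple gT) :
  central B a c -> (a <= c)%O -> (c <= B)%O -> compatible F f -> functional a c l ->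
  (forall j, tnth z j \in c) ->
  l (incr f x z) = (\sum_(i < k) l (incr f x [tuple if j == i then tnth z i else 1%g | j < k]))%R.
Proof.
move=> cac ac cB cf fl zc; have [lM l0] := fl.
pose tr (r : seq 'I_k) := [tuple if j \in r then tnth z j else 1 | j < k].
have trc r j : tnth (tr r) j \in c by rewrite tnth_mktuple; case: ifP.
suff key (r : seq 'I_k) : uniq r -> l (incr f x (tr r)) =
    (\sum_(i <- r) l (incr f x [tuple if j == i then tnth z i else 1%g | j < k]))%R.
  rewrite -key ?index_enum_uniq //; congr (l (incr f x _)).
  by apply: eq_from_tnth => j; rewrite tnth_mktuple mem_index_enum.
elim: r => [_|i r IHr /= /andP[ir ur]].
  rewrite big_nil l0 //; apply: incr_in => // j.
  by rewrite tnth_mktuple in_nil group1.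
have dc : forall j, tnth [tuple if j == i then tnth z i else 1 | j < k] j \in c.
  by move=> j; rewrite tnth_mktuple; case: ifP.
rewrite big_cons -IHr // -lM ?incr_in //.
apply: (functional_cls fl ac); first by apply: incr_in.
rewrite [RHS]clsM -(incr_additive x cB cac cf dc (trc r)); congr (cls a (incr f x _)).
apply: eq_from_tnth => j; rewrite !tnth_mktuple inE.
by case: eqP => [->|_] /=; rewrite ?(negPf ir) ?mulg1 ?mul1g.
Qed.

(** Write a term g as its representative modulo c times the remaining part in
    c. For an operation f applied to terms, the part in c of the result is a
    function of the classes of the arguments modulo c, which have degree at
    most d, plus the increment of f in the direction of the parts in c of the
    arguments. By centrality that increment is a fixed sum of functionals of
    these parts, whatever the vertex of the cube. So functionals of the parts
    in c keep the degree bound [E], however deep the composition is. *)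
Lemma term_degree_step a c d : pcentral B p a c -> (a <= c)%O -> (c <= B)%O ->
  (forall n (g : cube n -> gT), term g -> degree_le c d g) ->
  exists d', forall n (g : cube n -> gT), term g -> degree_le a d' g.
Proof.
move=> pc ac cB dc; have [cac _] := pc.
pose E := maxn 1 (N * d).
pose zpart n (g : cube n -> gT) Y := (rep c (g Y))^-1 * g Y.
have zc n (g : cube n -> gT) Y : zpart n g Y \in c by rewrite -cls_eq cls_rep.
have lowz n (g : cube n -> gT) : term g -> forall l, functional a c l ->
    lowdeg E (fun Y => l (zpart n g Y)).
  elim=> {g} [i l _|k f g Gf tg IH l fl].
    apply: (@lowdeg_junta _ _ _ [set i]); first by rewrite cards1 leq_maxl.
    by move=> Y; rewrite /zpart inE set11 andbT.
  have cf := G_compatible Gf.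
  (* The terms are constant modulo B, so any vertex gives a base point. *)
  pose G0 := [tuple g i set0 | i < k].
  pose s Y := [tuple rep c (g i Y) | i < k].
  pose z Y := [tuple zpart n (g i) Y | i < k].
  have zE Y : [tuple g i Y | i < k] = tmul (s Y) (z Y).
    by apply: eq_from_tnth => i; rewrite !tnth_mktuple mulKVg.
  have zYc Y j : tnth (z Y) j \in c by rewrite tnth_mktuple.
  pose psi (u : k.-tuple gT) := l ((rep c (f [tuple rep c (tnth u i) | i < k]))^-1
     * f [tuple rep c (tnth u i) | i < k]).
  have e Y : l (zpart n (fun Y => f [tuple g i Y | i < k]) Y) =
      (psi [tuple g i Y | i < k] + \sum_(i < k)
        l (incr f G0 [tuple if j == i then zpart n (g i) Y else 1%g | j < k]))%R.
    have es : [tuple rep c (tnth [tuple g i Y | i < k] i) | i < k] = s Y.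
      by apply: eq_from_tnth => i; rewrite !tnth_mktuple.
    rewrite /zpart /psi es.
    have -> : (rep c (f [tuple g i Y | i < k]))^-1 * f [tuple g i Y | i < k] =
       ((rep c (f (s Y)))^-1 * f (s Y)) * incr f (s Y) (z Y).
      rewrite (@rep_cls _ _ c (f [tuple g i Y | i < k]) (f (s Y))); last first.
        by apply: cf => i; rewrite !tnth_mktuple cls_rep.
      by rewrite /incr mulgA mulgK zE.
    have [lM _] := fl; rewrite lM ?incr_in //; last by rewrite -cls_eq cls_rep.
    congr (_ + _)%R.
    have -> : l (incr f (s Y) (z Y)) = l (incr f G0 (z Y)).
      apply: (functional_cls fl ac); first exact: incr_in.
      apply: cac => // i; rewrite !tnth_mktuple.
      by rewrite (cls_le cB (cls_rep c _)); apply: term_base.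
    rewrite (incr_functional _ cac ac cB) //; apply: eq_bigr => i _.
    by congr (l (incr f G0 _)); apply: eq_from_tnth => j; rewrite !tnth_mktuple.
  apply: lowdeg_ext e _; apply: lowdegD.
    apply: (@lowdeg_le _ _ (k * d)).
      by rewrite leq_max leq_mul2r (G_arity Gf) !orbT.
    apply: degree_le_tuple => [i|u v uv]; first exact: dc.
    rewrite /psi; congr (l (_^-1 * _)).
      by apply/rep_cls/cf => i; rewrite !tnth_mktuple !cls_rep.
    by congr (f _); apply: eq_from_tnth => i; rewrite !tnth_mktuple; apply: rep_cls.
  apply: lowdeg_bigsum => i.
  apply: (IH i (fun w => l (incr f G0 [tuple if j == i then w else 1%g | j < k]))).
  pose sg (w : gT) : k.-tuple gT := [tuple if j == i then w else 1 | j < k].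
  have sgc I w : w \in I -> forall j, tnth (sg w) j \in I.
    by move=> wI j; rewrite tnth_mktuple; case: ifP.
  have [lM l0] := fl; split=> [u v uc vc|u ua]; last by apply/l0/incr_in/sgc.
  rewrite -lM ?incr_in //; try exact: sgc.
  apply: (functional_cls fl ac); first by apply/incr_in/sgc; rewrite ?groupM.
  rewrite [RHS]clsM -(incr_additive _ cB cac cf (sgc _ _ uc) (sgc _ _ vc)).
  congr (cls a (incr f G0 _)); apply: eq_from_tnth => j; rewrite !tnth_mktuple.
  by case: ifP => _; rewrite ?mulg1.
exists (d + M * E)%N => n g tg phi inv.
(* Distinguish the class s modulo c, of degree d; on it, phi is a function of
   the part in c. *)
apply: (@lowdeg_ext _ _ _ (fun Y => \sum_(s : gT)
   ((rep c (g Y) == s)%:R * phi (s * zpart n g Y)%g))%R) => [Y|].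
  rewrite (bigD1 (rep c (g Y))) //= eqxx GRing.mul1r mulKVg big1 ?GRing.addr0 // => s ns.
  by rewrite eq_sym (negPf ns) GRing.mul0r.
apply: lowdeg_bigsum => s; apply: lowdegM.
  by apply: (dc _ _ tg (fun x => (rep c x == s)%:R)%R) => x y e; rewrite (rep_cls e).
apply: (lowdeg_of_functionals pc ac cB (zc n g) (lowz n g tg)
  (chi := fun w => phi (s * w))) => x y e.
by apply: inv; rewrite !clsM e.
Qed.

Lemma term_degree (D : ideal F) : (D <= B)%O ->
  (forall a b, (D <= a)%O -> covers a b -> (b <= B)%O -> pcentral B p a b) ->
  exists d, forall n (g : cube n -> gT), term g -> degree_le D d g.
Proof.
move=> DB edge.
suff key m b : (#|b| < m)%N -> (D <= b)%O -> (b <= B)%O ->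
    (exists d, forall n (g : cube n -> gT), term g -> degree_le b d g) ->
    exists d, forall n (g : cube n -> gT), term g -> degree_le D d g.
  apply: (key _ B (ltnSn _)) => //; exists 0 => n g tg phi inv.
  apply: (@lowdeg_junta _ _ _ set0) => [|Y]; rewrite ?cards0 //.
  exact/inv/term_base.
elim: m b => // m IHm b bm Db bB [d dP].
have [e|ne] := eqVneq D b; first by exists d; rewrite e.
have [|a Da cov] := exists_cover (a := D) (b := b); first by rewrite lt_neqAle ne.
have [ab _] := cov; apply: (IHm a) => //.
- rewrite -ltnS (leq_trans _ bm) // ltnS.
  exact: ideal_card_lt.
- exact: le_trans (ltW ab) bB.
by apply: (term_degree_step (edge _ _ Da cov bB)) (ltW ab) bB dP.
Qed.

End Terms.
End CubeDegree.

(** * A splitting layer prevents finite generation *)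

Section NotFinitelyGenerated.
Local Open Scope group_scope.
Variables (gT : finGroupType) (F : opset gT).
Hypothesis F_expanded : expanded_group F.
Hypothesis M2F : M2_free (ideal F).
Variables D B : ideal F.
Hypotheses (cutD : cuts D) (cutB : cuts B) (DB : (D < B)%O).
Hypothesis no_cut : forall c, (D < c < B)%O -> ~ cuts c.
Hypothesis large : lat_interval D B <> [set D; B].

(** A lower cover m1 of B above an ideal strictly inside the layer does not
    cut, and an ideal incomparable to it lies below another lower cover. *)
Lemma two_coatoms : exists m1 m2,
  [/\ covers m1 B, covers m2 B, (D <= m1)%O, (D <= m2)%O & m1 != m2].
Proof.
have [c /andP[Dc cB]] : exists c, (D < c < B)%O.
  apply: contrapT => no; apply: large; apply/setP=> c; rewrite !inE.
  apply/idP/idP=> [/andP[Dc cB]|/orP[]/eqP->]; rewrite ?lexx ?(ltW DB) //.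
  rewrite eq_sym; apply: contrapT => /negP; rewrite negb_or => /andP[n1 n2].
  by apply: no; exists c; rewrite !lt_neqAle n1 n2 Dc.
have [m1 cm1 cov1] := exists_cover cB; have [m1B _] := cov1.
have Dm1 := lt_le_trans Dc cm1.
have [y [ny1 ny2]] : exists y, ~ (y <= m1)%O /\ ~ (m1 <= y)%O.
  apply: contrapT => no; apply: (no_cut (c := m1)); first by rewrite Dm1.
  move=> y; apply: contrapT => nor; apply: no; exists y.
  by split=> h; apply: nor; [left|right].
have Dy : (D <= y)%O by have [/le_trans yD|//] := cutD y; case: ny1; apply/yD/ltW.
have yB : (y < B)%O.
  have [yB|By] := cutB y; last by case: ny2; apply: le_trans By; apply: ltW.
  by rewrite lt_neqAle yB andbT; apply/eqP=> e; case: ny2; rewrite e ltW.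
have [m2 ym2 cov2] := exists_cover yB.
exists m1, m2; split=> //; [exact: ltW|exact: le_trans Dy ym2|].
by apply/eqP=> e; apply: ny1; rewrite e.
Qed.

(** The diamond below B yields centrality and the exponent p for one lower
    cover of B; both properties are invariant under transposition. *)
Lemma all_covers_pcentral : exists2 p, prime p & forall a b : ideal F,
  (D <= a)%O -> covers a b -> (b <= B)%O -> pcentral B p a b.
Proof.
have [m1 [m2 [cov1 cov2 Dm1 Dm2 ne]]] := two_coatoms.
have [m3 [m3B j1 j2 m31 m32]] := third_cover M2F cov1 cov2 ne.
have cm1 : central B m1 B.
  apply: (@central_top _ _ _ _ m2 m3) => //.
  have [m2B _] := cov2.
  by apply: cover_join => //; [exact: ltW|apply: cover_incomparable cov2 cov1 _; rewrite eq_sym].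
have [p p_pr pm1] := cover_exponent F_expanded cov1 cm1.
exists p => // a b; apply: (@covers_transposed _ _ M2F (pcentral B p)) => //.
- by move=> a' b' c; apply: pcentral_up.
- by move=> b' c d; apply: pcentral_down.
move=> a' _ cova; apply: (@cover_transfer _ _ M2F (pcentral B p)) cov1 cova pm1.
- by move=> a1 b' c; apply: pcentral_up.
- by move=> b' c d; apply: pcentral_down.
Qed.

(** The conjunction of the conditions that an argument is outside delta has
    arbitrarily large degree modulo D. *)
Lemma splits_not_finitely_generated : interval_splits D B ->
  ~ finitely_generated (congruence_preserving F).
Proof.
move=> [delta [eps [dDB eDB dB De sp]]] [s [sC Cs]].
have [p p_pr edge] := all_covers_pcentral.
have [/andP[Dd _] /andP[_ eB]] : (D <= delta <= B)%O /\ (D <= eps <= B)%O.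
  by move: dDB eDB; rewrite !inE.
have spA (alpha : ideal F) : (alpha <= delta \/ eps <= alpha)%O.
  have [aD|Da] := cutD alpha; first by left; apply: le_trans Dd.
  have [aB|Ba] := cutB alpha; last by right; apply: le_trans Ba.
  by apply: sp; rewrite inE Da.
have /subsetPn[b0 b0B b0d] : ~~ (B \subset delta) by rewrite -ideal_leE (lt_geF dB).
have /subsetPn[e eE eD] : ~~ (eps \subset D) by rewrite -ideal_leE (lt_geF De).
pose N := \max_(q <- s) tag q.
have [k f fs|k f fs|d dP] :=
  @term_degree _ _ B p p_pr (opset_of_seq s) N b0 _ _ b0B D (ltW DB) edge.
- by have /congruence_preservingP[] := sC k f fs.
- by rewrite /N (big_rem _ fs) leq_maxl.
pose f (x : (d.+1).-tuple gT) := if [forall j, tnth x j \notin delta] then e else 1.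
have cf : congruence_preserving F [ffun x => f x].
  apply/congruence_preservingP => //; split=> //.
  have cf : compatible F f.
    apply: (split_compatible spA) => [u v uv|u]; last by rewrite /f; case: ifP.
    rewrite /f; congr (if _ then _ else _); apply: eq_forallb => j.
    by rewrite -!cls_eq1 uv.
  by move=> I u v uv; rewrite !ffunE; apply: cf.
pose x (i : 'I_d.+1) (Y : {set 'I_d.+1}) := if i \in Y then b0 else 1.
have := clone_term (b0 := b0) (g := x) (Cs _ _ cf) (fun i => term_var _ _ i).
move=> /dP /(_ (fun y => (cls D y == cls D e)%:R)%R) low.
have {low} : lowdeg d (fun Y : {set 'I_d.+1} => (Y == setT)%:R : 'F_p)%R.
  apply: lowdeg_ext (low _) => [Y|u v ->//]; rewrite ffunE /f.
  have -> : [forall j, tnth [tuple x i Y | i < d.+1] j \notin delta] = (Y == setT).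
    apply/forallP/eqP => [h|-> j]; last by rewrite tnth_mktuple /x inE.
    apply/setP=> j; rewrite inE; have := h j; rewrite tnth_mktuple /x.
    by case: ifP => //; rewrite group1.
  case: eqP => _; first by rewrite eqxx.
  by rewrite cls1 eq_sym cls_eq1 (negPf eD).
move=> /(lowdeg_alternating (ltnSn d))/eqP.
rewrite (bigD1 setT) //= eqxx GRing.mulr1 big1 ?GRing.addr0 => [|Y /negPf->].
  by rewrite GRing.signr_eq0.
by rewrite GRing.mulr0.
Qed.

End NotFinitelyGenerated.

Theorem theorem2p4 (gT : finGroupType) (F : opset gT)
  (F_expanded : expanded_group F)
  (IdA_M2_free : M2_free (ideal F))
  (n : nat) (S_ : nat -> ideal F)
  (S_first : S_ 0 = [set 1%g] :> {set gT})
  (S_last : S_ n = [set: gT] :> {set gT})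
  (S_increasing : forall i : nat, i < n -> (S_ i < S_ i.+1)%O)
  (S_cutting : forall beta : ideal F,
     cuts beta <-> exists2 i : nat, i <= n & beta = S_ i) :
  finitely_generated (congruence_preserving F) <->
  (forall i : nat, i < n ->
     lat_interval (S_ i) (S_ i.+1) = [set S_ i; S_ i.+1]
     \/ ~ interval_splits (S_ i) (S_ i.+1)).
Proof.
have cutS i : i <= n -> cuts (S_ i) by move=> lei; apply/S_cutting; exists i.
split=> [fg i lt_in|lay]; last first.
  exact: (cut_layers_finitely_generated F_expanded S_first S_last).
have [two|large] := pselect (lat_interval (S_ i) (S_ i.+1) = [set S_ i; S_ i.+1]).
  by left.
right=> split_i; move: fg.
apply: (@splits_not_finitely_generated _ _ F_expanded IdA_M2_free _ _ _ _ _ _ large split_i).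
- exact/cutS/ltnW.
- exact: cutS.
- exact: S_increasing.
have mono j l : j <= l -> l <= n -> (S_ j <= S_ l)%O.
  elim: l => [|l IHl]; first by rewrite leqn0 => /eqP->.
  rewrite leq_eqVlt => /predU1P[->//|jl] ln.
  exact: le_trans (IHl jl (ltnW ln)) (ltW (S_increasing _ ln)).
move=> c /andP[ic ci] /S_cutting[j jn ec]; rewrite {c}ec in ic ci.
have [ji|ij] := leqP j i.
  by have := mono _ _ ji (ltnW lt_in); rewrite (lt_geF ic).
by have := mono _ _ ij jn; rewrite (lt_geF ci).
Qed.
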